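(* Let $F$ be a smooth, symmetric, homogeneous degree $1$ function defined on the positive quadrant $\{(a,b)\in\mathbb{R}^2: a>0,\ b>0\}$, with strictly positive partial derivative in each argument, normalized to have $F(1,1)=1$. If $x:S^2\times[0,T)\to\mathbb{R}^3$ is a smooth family of convex embeddings (with positive principal curvatures) satisfying $$\frac{\partial x}{\partial t}(z,t)=-F(\kappa_1(z,t),\kappa_2(z,t))\,\nu(z,t),\qquad x(z,0)=x_0(z),$$ then for every $t\in(0,T)$ the pinching ratio of $M_t=x_t(S^2)$, where $x_t=x(\cdot,t)$, is no greater than the pinching ratio of $M_0=x_0(S^2)$.
   Context: Here $\nu(z,t)$ is the outward unit normal and $\kappa_1(z,t),\kappa_2(z,t)$ are the principal curvatures of $M_t$ at $x(z,t)$, with the sign convention that they are positive on convex surfaces (eigenvalues of $h_{ij}=-\langle \partial_i\partial_j x,\nu\rangle$ with respect to the induced metric). The pinching ratio of a convex surface with positive principal curvatures is the supremum over the surface of the ratio of the largest to the smallest principal curvature at each point. *)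

(* Defs.v *)
From HB Require Import structures.
From mathcomp Require Export all_boot all_order all_algebra.
From mathcomp Require Export all_classical all_reals all_analysis.

Set Implicit Arguments.
Unset Strict Implicit.
Unset Printing Implicit Defensive.

Export Order.TTheory GRing.Theory Num.Theory.
Export numFieldNormedType.Exports.

Local Open Scope classical_set_scope.
Local Open Scope ring_scope.

(* For open U in a finite-dimensional V this is C^oo: all iterated directional
   derivatives exist and are Frechet differentiable, hence continuous. *)
Definition smooth_open (R : realType) (V W : normedModType R)
    (U : set V) (f : V -> W) : Prop :=
  forall (vs : seq V) (p : V), U p ->
    differentiable (foldr (fun v (g : V -> W) => fun q => 'D_v g q) f vs) p.

(* Smoothness on an arbitrary subset (e.g. up to a boundary): f agrees near
   each point of A with a function that is smooth on an open set. *)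
Definition smooth_on (R : realType) (V W : normedModType R)
    (A : set V) (f : V -> W) : Prop :=
  forall p, A p -> exists (U : set V) (g : V -> W),
    [/\ open U, U p, smooth_open U g & {in A `&` U, f =1 g}].

Definition quadrant (R : realType) : set (R * R) :=
  [set p | 0 < p.1 /\ 0 < p.2].

Definition dot (R : realType) (n : nat) (u v : 'rV[R]_n) : R :=
  \sum_(i < n) u 0 i * v 0 i.

(* The unit sphere of R^3.  Functions on it are represented by functions on
   'rV_3; only their values on the sphere are ever used. *)
Definition sphere2 (R : realType) : set 'rV[R]_3 := [set z | dot z z = 1].

(* Inverse stereographic projections from the poles (0, 0, 1) and (0, 0, -1).
   They map R^2 onto the sphere minus a pole and are the local coordinates
   defining the smooth structure of the sphere. *)
Definition stereo (R : realType) (s : bool) (w : 'rV[R]_2) : 'rV[R]_3 :=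
  (1 + dot w w)^-1 *:
  \row_(k < 3) [:: 2 * w 0 0; 2 * w 0 1; (-1) ^+ s * (dot w w - 1)]`_k.

Definition partial (R : realType) (n m : nat) (i : 'I_n)
    (X : 'rV[R]_n -> 'rV[R]_m) (w : 'rV[R]_n) : 'rV[R]_m :=
  'D_(delta_mx 0 i) X w.

Definition metric (R : realType) (X : 'rV[R]_2 -> 'rV[R]_3) (w : 'rV[R]_2) :
    'M[R]_2 :=
  \matrix_(i, j) dot (partial i X w) (partial j X w).

Definition second_form (R : realType) (X : 'rV[R]_2 -> 'rV[R]_3)
    (n : 'rV[R]_3) (w : 'rV[R]_2) : 'M[R]_2 :=
  \matrix_(i, j) - dot (partial i (partial j X) w) n.

Definition smooth_embedding (R : realType) (f : 'rV[R]_3 -> 'rV[R]_3) : Prop :=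
  [/\ forall s, smooth_open [set: 'rV[R]_2] (f \o stereo s),
      forall s (w : 'rV[R]_2), injective ('d (f \o stereo s) w)
    & exists g : 'rV[R]_3 -> 'rV[R]_3,
        {within f @` @sphere2 R, continuous g} /\
        forall z, sphere2 z -> g (f z) = z].

Definition convex_body (R : realType) (K : set 'rV[R]_3) : Prop :=
  [/\ compact K, convex_set K & K° !=set0].

(* K being closed, K `\` K° is its topological boundary. *)
Definition encloses (R : realType) (f : 'rV[R]_3 -> 'rV[R]_3)
    (K : set 'rV[R]_3) : Prop :=
  convex_body K /\ f @` @sphere2 R = K `\` K°.

Definition convex_embedding (R : realType) (f : 'rV[R]_3 -> 'rV[R]_3) : Prop :=
  smooth_embedding f /\ exists K, encloses f K.

(* n is the unit normal of the convex surface f(S^2) at f z that points out of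
   the enclosed body (which is unique, being the convex hull of f(S^2)). *)
Definition outward_unit_normal (R : realType) (f : 'rV[R]_3 -> 'rV[R]_3)
    (z n : 'rV[R]_3) : Prop :=
  [/\ dot n n = 1,
      forall s (w : 'rV[R]_2), stereo s w = z ->
        forall i, dot (partial i (f \o stereo s) w) n = 0
    & exists2 K, encloses f K & \forall e \near (0 : R)^'+, ~ K (f z + e *: n)].

(* a and b are the eigenvalues, with multiplicity, of h_ij = - <d_i d_j f, n>
   with respect to the induced metric g_ij = <d_i f, d_j f>, that is, of the
   matrix g^-1 h, in each of the two coordinate systems around z. *)
Definition principal_curvatures (R : realType) (f : 'rV[R]_3 -> 'rV[R]_3)
    (z n : 'rV[R]_3) (a b : R) : Prop :=
  forall s (w : 'rV[R]_2), stereo s w = z ->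
    char_poly (invmx (metric (f \o stereo s) w) *m
               second_form (f \o stereo s) n w)
    = ('X - a%:P) * ('X - b%:P).

(* The supremum is taken in the extended reals, so that it is meaningful
   without any a priori bound. *)
Definition pinching_ratio (R : realType) (f : 'rV[R]_3 -> 'rV[R]_3) : \bar R :=
  ereal_sup [set r | exists z n a b,
    [/\ sphere2 z, outward_unit_normal f z n, principal_curvatures f z n a b
      & r = (Num.max a b / Num.min a b)%:E]].

Definition admissible_speed (R : realType) (F : R -> R -> R) : Prop :=
  [/\ smooth_open (@quadrant R) (fun p : R * R => F p.1 p.2),
      forall a b, 0 < a -> 0 < b -> F a b = F b a,
      forall c a b, 0 < c -> 0 < a -> 0 < b -> F (c * a) (c * b) = c * F a b,
      forall a b, 0 < a -> 0 < b ->
        0 < derive1 (F^~ b) a /\ 0 < derive1 (F a) b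
    & F 1 1 = 1].

Definition smooth_family (R : realType) (T : R)
    (x : 'rV[R]_3 -> R -> 'rV[R]_3) : Prop :=
  forall s, smooth_on ([set: 'rV[R]_2] `*` [set t : R | 0 <= t < T])
    (fun p : 'rV[R]_2 * R => x (stereo s p.1) p.2).

(* The time derivative relative to [0, T[; one-sided at t = 0. *)
Definition has_time_derivative (R : realType) (T : R)
    (y : R -> 'rV[R]_3) (t : R) (v : 'rV[R]_3) : Prop :=
  (fun u => (u - t)^-1 *: (y u - y t))
    @ within [set u : R | 0 <= u < T] t^' --> v.

(* Main.v *)
(* Let G = (k1 + k2)^2 / (k1 k2) = r + 1/r + 2, where r >= 1 is the ratio of the
   principal curvatures, so that it suffices to bound max G by its initial
   value.  Otherwise G - e t, for some small e > 0, has a maximum over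
   S^2 x [0, t0] at a positive time, at a point which is not umbilic because
   G > 4 there.  Near that point F(k1, k2) = (k1 + k2) psi(G) with psi
   differentiable.  In an orthonormal principal frame, using G_1 = G_2 = 0 and
   the Codazzi equations, one finds
     G_t = F_1 G_11 + F_2 G_22 - (a positive multiple of a sum of squares):
   the zero order terms cancel by homogeneity, and no second derivative of F
   occurs because G is critical.  Hence G_t <= 0, whereas maximality of
   G - e t gives G_t >= e.
   Instead of using covariant derivatives, this identity is checked on the
   Taylor expansions, along the lines of a chart of the sphere, of the
   parametrization; G <= c is then written as a polynomial inequality. *)

(* No regularity in z and t is assumed of [nu], [k1], [k2]; the two curvatures may even be exchanged
   from point to point. Everything that is differentiated is therefore a polynomial in the first and
   second derivatives of the parametrization, and the normal enters only pointwise. Jets along the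
   two principal lines and the time axis suffice for the following reason. At the base point g_12
   and the 12-entry of the second form vanish, so the mixed derivative of the velocity drops out of
   the first time derivative of the defect. The Codazzi and Gauss equations are never stated. They
   are contained in the symmetry of iterated derivatives: the jets along the two lines share the
   third derivatives X_112, X_122 and the fourth derivative X_1122. A point that is not umbilic is
   needed twice: psi contains a square root that is not differentiable at 4, and the vanishing of
   the gradient of the defect has to be divided by k1 - k2. *)
From HB Require Import structures.
Require Import Defs.
From mathcomp Require Import ring lra.

Set Implicit Arguments.
Unset Strict Implicit.
Unset Printing Implicit Defensive.

Local Open Scope classical_set_scope.
Local Open Scope ring_scope.

(** * Second order jets of functions of one variable *)

Section Jets.
Variable R : realType.
Implicit Types (f g : R -> R) (j k : R * R * R).

Lemma cvg_limit_eq (T : Type) (F : set_system T) (h : T -> R) (a b : R) :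
  h @ F --> a -> a = b -> h @ F --> b.
Proof. by move=> ha <-. Qed.

(* jet2 f (a, b, c) means f s = a + b s + (c / 2) s^2 + o(s^2) as s -> 0. *)
Definition jet2 f j : Prop := exists2 q : R -> R, q @ (0 : R) --> j.2 &
  \forall s \near (0 : R), f s = j.1.1 + j.1.2 * s + q s / 2 * s ^+ 2.

Definition jcst (a : R) : R * R * R := (a, 0, 0).
Definition jadd j k := (j.1.1 + k.1.1, j.1.2 + k.1.2, j.2 + k.2).
Definition jopp j := (- j.1.1, - j.1.2, - j.2).
Definition jsub j k := jadd j (jopp k).
Definition jmul j k := (j.1.1 * k.1.1, j.1.1 * k.1.2 + j.1.2 * k.1.1,
  j.1.1 * k.2 + 2 * j.1.2 * k.1.2 + j.2 * k.1.1).
Definition jinv j := (j.1.1^-1, - j.1.2 / j.1.1 ^+ 2,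
  (2 * j.1.2 ^+ 2 - j.1.1 * j.2) / j.1.1 ^+ 3).

Lemma jet2_near f g j : (\forall s \near (0 : R), f s = g s) ->
  jet2 f j -> jet2 g j.
Proof.
move=> fg [q q0 fE]; exists q => //.
by near=> s; rewrite -(near fg s)// (near fE s).
Unshelve. all: by end_near. Qed.

Lemma jet2_ext f g j : f =1 g -> jet2 f j -> jet2 g j.
Proof. by move=> /funext ->. Qed.

Lemma jet2_val f j : jet2 f j -> f 0 = j.1.1.
Proof. by case=> q _ /nbhs_singleton ->; ring. Qed.

Lemma jet2_cst a : jet2 (fun=> a) (jcst a).
Proof.
exists (fun=> 0); first exact: cvg_cst.
by near=> s => /=; ring.
Unshelve. all: by end_near. Qed.

Lemma jet2_id : jet2 id (0, 1, 0).
Proof.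
exists (fun=> 0); first exact: cvg_cst.
by near=> s => /=; ring.
Unshelve. all: by end_near. Qed.

Lemma jet2D f g j k : jet2 f j -> jet2 g k ->
  jet2 (fun s => f s + g s) (jadd j k).
Proof.
case: j k => [[a b] c] [[a' b'] c'] [q q0 /= fE] [r r0 /= gE]; exists (fun s => q s + r
  s); first exact: cvgD.
by near=> s; rewrite (near fE s)// (near gE s)//=; field.
Unshelve. all: by end_near. Qed.

Lemma jet2N f j : jet2 f j -> jet2 (fun s => - f s) (jopp j).
Proof.
case: j => [[a b] c] [q q0 /= fE]; exists (fun s => - q s); first exact: cvgN.
by near=> s; rewrite (near fE s)//=; ring.
Unshelve. all: by end_near. Qed.

Lemma jet2B f g j k : jet2 f j -> jet2 g k ->
  jet2 (fun s => f s - g s) (jadd j (jopp k)).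
Proof. by move=> fj /jet2N; exact: jet2D. Qed.

Lemma jet2M f g j k : jet2 f j -> jet2 g k ->
  jet2 (fun s => f s * g s) (jmul j k).
Proof.
case: j k => [[a b] c] [[a' b'] c'] [q q0 /= fE] [r r0 /= gE].
(* The witness is twice the part of order two and more of the expanded product, divided by
   [s ^+ 2]. *)
exists (fun s => a * r s + 2 * b * b' + q s * a' +
  (b * r s + q s * b') * s + q s * r s / 2 * s * s); last first.
  by near=> s; rewrite (near fE s)// (near gE s)//=; field.
apply: (@cvg_limit_eq _ _ _ (a * c' + 2 * b * b' + c * a' +
  (b * c' + c * b') * 0 + c * c' / 2 * 0 * 0)); last by rewrite /=; ring.
have id0 : id @ (0 : R) --> (0 : R) by exact: cvg_id.
have cc (x : R) : (fun _ : R => x) @ (0 : R) --> x by exact: cvg_cst.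
exact: (cvgD (cvgD (cvgD (cvgD (cvgM (cc a) r0) (cc _)) (cvgM q0 (cc a')))
  (cvgM (cvgD (cvgM (cc b) r0) (cvgM q0 (cc b'))) id0))
  (cvgM (cvgM (cvgM (cvgM q0 r0) (cc _)) id0) id0)).
Unshelve. all: by end_near. Qed.

Lemma jet2_cvg f j : jet2 f j -> f @ (0 : R) --> j.1.1.
Proof.
case: j => [[a b] c] [q q0 /= fE].
have hq : (fun s => a + b * s + q s / 2 * s * s) @ (0 : R) --> a.
  apply: (@cvg_limit_eq _ _ _ (a + b * 0 + c / 2 * 0 * 0)); last by ring.
  have id0 : id @ (0 : R) --> (0 : R) by exact: cvg_id.
  have cc (x : R) : (fun _ : R => x) @ (0 : R) --> x by exact: cvg_cst.
  exact: (cvgD (cvgD (cc a) (cvgM (cc b) id0)) (cvgM (cvgM (cvgM q0 (cc _)) id0) id0)).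
apply: cvg_trans hq.
by apply: near_eq_cvg; near=> s; rewrite (near fE s)// expr2 mulrA.
Unshelve. all: by end_near. Qed.

Lemma jet2V f j : jet2 f j -> j.1.1 != 0 -> jet2 (fun s => (f s)^-1) (jinv j).
Proof.
case: j => [[a b] c] fj /= a0; have fcvg := jet2_cvg fj.
case: fj => q q0 /= fE.
have fN0 : \forall s \near (0 : R), f s != 0.
  exact: (fcvg _ (open_nbhs_nbhs (conj (@open_neq R 0) a0))).
(* Solving [(f s)^-1 = a^-1 - b / a ^+ 2 * s + q' / 2 * s ^+ 2] for [q'] gives this remainder, in
   which no division by [s] is left. *)
exists (fun s => (2 * b ^+ 2 - a * q s + b * q s * s) *
    (a ^+ 2 * f s)^-1); last first.
  near=> s; have fs0 : f s != 0 by near: s.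
  have fs : f s = a + b * s + q s / 2 * s ^+ 2 by near: s.
  move: fs0; rewrite /= fs; have -> : q s = 2 * (q s / 2) by field.
  set u := q s / 2; have -> : 2 * u / 2 = u by field.
  by move=> fs0; field; apply/andP; split; [exact: fs0|exact: a0].
apply: (@cvg_limit_eq _ _ _ ((2 * b ^+ 2 - a * c + b * c * 0) *
    (a ^+ 2 * a)^-1)); last by rewrite /=; field.
have id0 : id @ (0 : R) --> (0 : R) by exact: cvg_id.
apply: cvgM; last apply: cvgV; last first.
- by apply: cvgM => //; exact: cvg_cst.
- by rewrite mulf_neq0 // expf_neq0.
have cc (x : R) : (fun _ : R => x) @ (0 : R) --> x by exact: cvg_cst.
exact: (cvgD (cvgB (cc _) (cvgM (cc a) q0)) (cvgM (cvgM (cc b) q0) id0)).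
Unshelve. all: by end_near. Qed.

Lemma jet2_slope_cvg f j : jet2 f j -> j.1.1 = 0 ->
  exists2 h : R -> R, h @ (0 : R) --> j.1.2 &
  \forall s \near (0 : R), f s = h s * s.
Proof.
case: j => [[a b] c] [q q0 /= fE] a0; exists (fun s => b + q s / 2 * s).
  apply: (@cvg_limit_eq _ _ _ (b + c / 2 * 0)); last by ring.
  apply: cvgD; first exact: cvg_cst.
  by apply: cvgM; [apply: cvgM => //; exact: cvg_cst|exact: cvg_id].
by near=> s; rewrite (near fE s)// a0; ring.
Unshelve. all: by end_near. Qed.

(** One side only, because the maximum over a time interval may occur at its final time. *)
Lemma jet2_left_max f j : jet2 f j -> j.1.1 = 0 ->
  (\forall s \near (0 : R)^'-, f s <= 0) -> 0 <= j.1.2.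
Proof.
move=> fj j0 fle; have [h h0 fE] := jet2_slope_cvg fj j0.
have hl := cvg_at_left_filter h0.
apply: (cvgr_to_ge hl).
have fE' : \forall s \near (0 : R)^'-, f s = h s * s by exact: cvg_within fE.
near=> s; have s0 : s < 0 by near: s; exact: nbhs_left_lt.
by rewrite -(nmulr_lle0 _ s0) -(near fE' s)//; near: s.
Unshelve. all: by end_near. Qed.

Lemma jet2_max f j : jet2 f j -> j.1.1 = 0 ->
  (\forall s \near (0 : R), f s <= 0) -> j.1.2 = 0 /\ j.2 <= 0.
Proof.
move=> fj j0 fle; have [h h0 fE] := jet2_slope_cvg fj j0.
have j10 : j.1.2 = 0.
  apply/eqP; rewrite eq_le; apply/andP; split; last first.
    by apply: (jet2_left_max fj) => //; exact: cvg_within.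
  have hl := cvg_at_right_filter h0.
  apply: (cvgr_to_le hl).
  have fE' : \forall s \near (0 : R)^'+, f s = h s * s by exact: cvg_within fE.
  have fl' : \forall s \near (0 : R)^'+, f s <= 0 by exact: cvg_within fle.
  near=> s; have s0 : 0 < s by near: s; exact: nbhs_right_gt.
  by rewrite -(pmulr_lle0 _ s0) -(near fE' s)//; near: s.
split => //; case: fj => q q0 {}fE.
have fl' : \forall s \near (0 : R)^'+, f s <= 0 by exact: cvg_within fle.
have fE' : \forall s \near (0 : R)^'+,
    f s = j.1.1 + j.1.2 * s + q s / 2 * s ^+ 2 by exact: cvg_within fE.
have hl := cvg_at_right_filter q0.
apply: (cvgr_to_le hl).
near=> s; have s0 : 0 < s by near: s; exact: nbhs_right_gt.
have s2 : 0 < s ^+ 2 by rewrite exprn_gt0.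
have : q s / 2 * s ^+ 2 <= 0.
  have <- : f s = q s / 2 * s ^+ 2 by rewrite (near fE' s)// j0 j10; ring.
  by near: s.
by rewrite pmulr_lle0// pmulr_lle0// invr_gt0.
Unshelve. all: by end_near. Qed.

(** The difference of the jets, in either order, is a jet of the zero function, to which [jet2_max]
    applies. Uniqueness turns the flow equation into an equation between jets. *)
Lemma jet2_uniq f j k : jet2 f j -> jet2 f k -> j = k.
Proof.
move=> fj fk.
have z := jet2_ext (fun s => subrr (f s)) (jet2B fj fk).
have z' := jet2_ext (fun s => subrr (f s)) (jet2B fk fj).
have e0 : j.1.1 = k.1.1 by rewrite -(jet2_val fj) -(jet2_val fk).
have [] := jet2_max z; [by rewrite /= e0 subrr|by near=> s|move=> /= e1 l1].
have [] := jet2_max z'; [by rewrite /= e0 subrr|by near=> s|move=> /= _ l2].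
case: j k {fj fk z z'} e0 e1 l1 l2 => [[a b] c] [[a' b'] c'] /= -> /eqP.
rewrite subr_eq0 => /eqP -> l1 l2; congr (_, _, _).
by apply/eqP; rewrite eq_le -subr_le0 l1 -subr_le0 l2.
Unshelve. all: by end_near. Qed.

End Jets.

(** * Taylor's formula and composition for jets *)

Section Jets2.
Variable R : realType.
Implicit Types (f g : R -> R) (j k : R * R * R).

(** Carathéodory's form of differentiability: being valid at [h = 0] too, it can be composed with
    increments that may vanish. *)
Lemma is_derive_slope f (a d : R) : is_derive a 1 f d ->
  exists2 e : R -> R, e @ (0 : R) --> d & forall h, f (a + h) = f a + e h * h.
Proof.
case=> df <-; set d' := 'D_1 f a.
exists (fun h => if h == 0 then d' else h^-1 * (f (a + h) - f a)); last first.
  move=> h; case: eqP => [->|/eqP h0]; first by rewrite mulr0 !addr0.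
  by rewrite mulrAC mulVf// mul1r addrCA subrr addr0.
have dfl : (fun h => h^-1 *: ((f \o shift a) (h *: 1) - f a)) @ 0^' --> d' by [].
apply/cvgrPdist_le => e e0.
move/cvgrPdist_le : dfl => /(_ e e0); rewrite near_withinE.
apply: filterS => h /=; case: eqP => [_ _|/eqP h0]; first by rewrite subrr normr0 ltW.
by move=> /(_ isT); rewrite [h *: 1]mulr1 [h + a]addrC.
Qed.

Lemma MVT0 f (df : R -> R) (s : R) :
  (forall x : R, `|x| <= `|s| -> is_derive x 1 f (df x)) ->
  exists2 x, `|x| <= `|s| & f s - f 0 = df x * s.
Proof.
move=> fd; have ds x : `|x| <= `|s| -> {for x, continuous f}.
  by move=> /fd[/derivable1_diffP /differentiable_continuous].
have [s0|s0] := leP 0 s.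
  have [x||x] := @MVT_segment _ f df 0 s s0.
  - rewrite in_itv /= => /andP[x0 xs]; apply: fd.
    by rewrite !ger0_norm// ltW.
  - apply: continuous_in_subspaceT => x; rewrite inE /= in_itv /= => /andP[x0 xs].
    by apply: ds; rewrite !ger0_norm.
  - rewrite in_itv /= => /andP[x0 xs]; rewrite subr0 => e.
    by exists x => //; rewrite !ger0_norm.
have [x||x] := @MVT_segment _ f df s 0 (ltW s0).
- rewrite in_itv /= => /andP[x0 xs]; apply: fd.
  by rewrite !ler0_norm ?lerN2// ltW.
- apply: continuous_in_subspaceT => x; rewrite inE /= in_itv /= => /andP[x0 xs].
  by apply: ds; rewrite !ler0_norm ?lerN2// ltW.
- rewrite in_itv /= => /andP[x0 xs]; rewrite sub0r mulrN => e.
  exists x; first by rewrite !ler0_norm ?lerN2// ltW.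
  by rewrite -opprB e opprK.
Qed.

(** Without a linear term, [f s - a] is already of order [s ^+ 2], so a first derivative of [g]
    determines the whole jet. *)
Lemma jet2_comp f g a c d : jet2 f (a, 0, c) -> is_derive a 1 g d ->
  jet2 (g \o f) (g a, 0, d * c).
Proof.
move=> fj /is_derive_slope[e ed gE]; case: fj => q /= qc fE.
have id0 : id @ (0 : R) --> (0 : R) by exact: cvg_id.
have cc (x : R) : (fun _ : R => x) @ (0 : R) --> x by exact: cvg_cst.
exists (fun s => e (q s / 2 * s * s) * q s) => /=.
  have q0 : (fun s => q s / 2 * s * s) @ (0 : R) --> (0 : R).
    apply: (@cvg_limit_eq _ _ _ _ (c / 2 * 0 * 0)); last by rewrite !mulr0.
    exact: (cvgM (cvgM (cvgM qc (cc _)) id0) id0).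
  exact: (cvgM (cvg_comp _ _ q0 ed) qc).
near=> s; rewrite (near fE s)//= -(addrA a) gE mul0r add0r.
by rewrite expr2 !mulrA; field.
Unshelve. all: by end_near. Qed.

(** Taylor's formula with Peano remainder: the second derivative has to exist at 0 only. *)
Lemma jet2_of_derive f (df : R -> R) (c : R) :
  (\forall x \near (0 : R), is_derive (x : R) 1 f (df x)) -> is_derive (0 : R) 1 df c ->
  jet2 f (f 0, df 0, c).
Proof.
move=> fd /is_derive_slope[e ec dfE].
exists (fun s => if s == 0 then c
    else 2 * (f s - f 0 - df 0 * s) / s ^+ 2) => /=; last first.
  near=> s; case: eqP => [->|/eqP s0]; first by ring.
  by field.
apply/cvgrPdist_le => r r0.
move/cvgrPdist_le : ec => ec.
have r2 : 0 < r / 2 by rewrite divr_gt0.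
move: ec => /(_ (r / 2) r2) ec.
have /nbhs_ballP[d /= d0 dP] : \forall x \near (0 : R),
  is_derive (x : R) 1 f (df x) /\ `|c - e x| <= r / 2 by exact: filterI.
near=> s; case: eqP => [_|/eqP s0]; first by rewrite subrr normr0 ltW.
have sd : `|s| < d.
  by near: s; apply/nbhs_ballP; exists d => //= y; rewrite /ball /= sub0r normrN.
have inb (x : R) : `|x| <= `|s| -> is_derive x 1 f (df x) /\ `|c - e x| <= r / 2.
  by move=> xs; apply: dP; rewrite /ball /= sub0r normrN (le_lt_trans xs).
(* The derivative of [h] is [(e x - c) * x], at most [r / 2 * |s|] in absolute value for
   [|x| <= |s|]; the mean value theorem bounds [h s] accordingly. *)
pose h x := f x - f 0 - df 0 * x - c / 2 * x ^+ 2.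
have [x xs|x xs] := @MVT0 h (fun x => df x - df 0 - c * x) s.
  have [fx _] := inb x xs.
  apply: is_derive_eq; rewrite /GRing.scale /= !(mulr0, mulr1, subr0, oppr0).
  by rewrite -[LHS]/(_ + _); field.
have [_ cx] := inb x xs.
rewrite /h !(subrr, mulr0, expr0n, subr0) /= => hE.
have hE2 : f s - f 0 - df 0 * s = c / 2 * s ^+ 2 + (e x - c) * x * s.
  apply/eqP; rewrite -subr_eq0 -[X in _ == X](subrr ((e x - c) * x * s)).
  rewrite -subr_eq0; apply/eqP.
  have := dfE x; rewrite add0r => dfx.
  by move: hE; rewrite dfx => hE; apply/eqP; rewrite subr_eq0; apply/eqP; lra.
have -> : c - 2 * (f s - f 0 - df 0 * s) / s ^+ 2 = 2 * ((c - e x) * x / s).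
  by rewrite hE2; field.
rewrite normrM ger0_norm// mulrC -ler_pdivlMr// !normrM normfV -mulrA.
by rewrite -[leRHS]mulr1 ler_pM// ler_pdivrMr ?mul1r// normr_gt0.
Unshelve. all: by end_near. Qed.

End Jets2.

(** * Iterated directional derivatives *)

Section Smooth.
Variables (R : realType) (V : normedModType R).
Implicit Types (U : set V) (p q u v : V).

Lemma is_derive_line (f : V -> R) p u (x : R) : derivable f (p + x *: u) u ->
  is_derive x 1 (fun s => f (p + s *: u)) ('D_u f (p + x *: u)).
Proof.
have e : (fun h : R => h^-1 *: (((fun s : R => f (p + s *: u)) \o shift x) (h *: (1 : R))
    - f (p + x *: u))) =
  (fun h => h^-1 *: ((f \o shift (p + x *: u)) (h *: u) - f (p + x *: u))).
  apply/funext => h /=; congr (_ *: (f _ - _)).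
  by rewrite [h *: 1]mulr1 scalerDl addrCA.
by move=> df; split; rewrite /derivable /derive e.
Qed.

Lemma near_line U p u : open U -> U p -> \forall s \near (0 : R), U (p + s *: u).
Proof.
move=> oU Up.
have c : (fun s : R => p + s *: u) @ (0 : R) --> p.
  rewrite -[X in _ --> X]addr0 -(scale0r u).
  by apply: cvgD; [exact: cvg_cst|apply: cvgZr_tmp; exact: cvg_id].
by apply: c; exact: open_nbhs_nbhs.
Qed.

Lemma near_line2 U p u v : open U -> U p ->
  \forall h \near (0 : R), forall x y : R, `|x| <= `|h| -> `|y| <= `|h| ->
    U (p + x *: u + y *: v).
Proof.
move=> oU Up.
have /nbhs_normP[d /= d0 dU] : nbhs p U by exact: open_nbhs_nbhs.
have c0 : 0 < `|u| + `|v| + 1 by rewrite ltr_wpDl.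
near=> h => x y xh yh; apply: dU => /=.
rewrite /ball_ /= -addrA opprD addrA subrr sub0r normrN.
have hd : `|h| < d / (`|u| + `|v| + 1).
  near: h; apply: (@nbhs0_lt R R^o); exact: divr_gt0.
rewrite (le_lt_trans (ler_normD _ _))// !normrZ.
apply: (@le_lt_trans _ _ (`|h| * (`|u| + `|v|))).
  by rewrite mulrDr lerD// ler_wpM2r.
move: hd; rewrite ltr_pdivlMr//; apply: le_lt_trans.
by rewrite ler_wpM2l// lerDl.
Unshelve. all: by end_near. Qed.

Lemma smooth_open_derive (W : normedModType R) U (f : V -> W) v :
  smooth_open U f -> smooth_open U (fun q => 'D_v f q).
Proof. by move=> sf vs p Up; have := sf (rcons vs v) p Up; rewrite foldr_rcons. Qed.

Lemma smooth_open_differentiable (W : normedModType R) U (f : V -> W) p :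
  smooth_open U f -> U p -> differentiable f p.
Proof. by move=> sf Up; exact: (sf [::]). Qed.

Lemma derive_eq_open (W : normedModType R) U (f g : V -> W) p v : open U ->
  (forall q, U q -> f q = g q) -> U p -> 'D_v f p = 'D_v g p.
Proof.
move=> oU fg Up; apply: near_eq_derive.
have : nbhs p U by exact: open_nbhs_nbhs.
exact: filterS.
Qed.

(** The difference [g - f] vanishes near [p], hence is differentiable there with differential 0. *)
Lemma near_eq_differentiable (W : normedModType R) (f g : V -> W) p :
  {near p, f =1 g} -> differentiable f p -> differentiable g p.
Proof.
move=> fg df; pose h := g - f.
have hp : h p = 0 by rewrite /h /= !fctE (nbhs_singleton fg) subrr.
have ho : h \o shift p = cst (h p) + 0 +o_ (0 : V) id.
  apply/eqaddoP => _/posnumP[e].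
  move: fg; rewrite (near_shift 0 p) subr0.
  apply: filterS => y /=; rewrite hp /h !fctE => ->.
  by have -> : (0 : V -> W) y = 0 by []; rewrite subrr addr0 subr0 normr0 mulr_ge0.
have dh : 'd h p = 0 :> (V -> W).
  by apply: diff_unique => //; exact: cst_continuous.
have -> : g = f + h by rewrite /h addrC subrK.
apply: differentiableD => //; apply/diff_locallyP; rewrite dh; split => //.
exact: cst_continuous.
Qed.

Lemma smooth_open_linear (W W' : normedModType R) (L : {linear W -> W'}) U (f : V -> W) :
  continuous L -> open U -> smooth_open U f ->
  smooth_open U (L \o f) /\
  forall p v, U p -> 'D_v (L \o f) p = L ('D_v f p).
Proof.
move=> cL oU sf.
have dL (W0 : W) : differentiable L W0 by exact: linear_differentiable.
have step g : smooth_open U g -> forall p v, U p -> 'D_v (L \o g) p = L ('D_v g p).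
  move=> sg p v Up; have dg := smooth_open_differentiable sg Up.
  rewrite !deriveE//; last exact: differentiable_comp.
  by rewrite diff_comp// /comp diff_lin.
split; last exact: step.
move=> vs; have : forall p, U p ->
  foldr (fun v g => fun q => 'D_v g q) (L \o f) vs p
  = L (foldr (fun v g => fun q => 'D_v g q) f vs p).
  elim: vs => [//|v vs IH] p Up /=.
  rewrite (derive_eq_open v oU IH Up) step// => ws q Uq.
  by rewrite -foldr_cat; exact: sf.
move=> e p Up.
apply: (@near_eq_differentiable W' (L \o foldr (fun v g => fun q => 'D_v g q) f vs)).
  have : nbhs p U by exact: open_nbhs_nbhs.
  by apply: filterS => q Uq; rewrite [RHS]e.
by apply: differentiable_comp => //; exact: sf.
Qed.

(** The mean value theorem is applied along [u] to the difference in direction [v], then along [v]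
    to the derivative in direction [u]. *)
Lemma mixed_difference U (f : V -> R) p u v (h : R) :
  smooth_open U f ->
  (forall x y : R, `|x| <= `|h| -> `|y| <= `|h| -> U (p + x *: u + y *: v)) ->
  exists x y : R, [/\ `|x| <= `|h|, `|y| <= `|h| &
    f (p + h *: u + h *: v) - f (p + h *: u) - f (p + h *: v) + f p
    = 'D_v (fun q => 'D_u f q) (p + x *: u + y *: v) * h ^+ 2].
Proof.
move=> sf Uxy.
have sfu := smooth_open_derive u sf.
have der (g : V -> R) q w : smooth_open U g -> U q -> derivable g q w.
  by move=> sg Uq; apply: diff_derivable; exact: smooth_open_differentiable Uq.
pose phi x := f (p + h *: v + x *: u) - f (p + x *: u).
pose dphi x := 'D_u f (p + h *: v + x *: u) - 'D_u f (p + x *: u).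
have Ux x : `|x| <= `|h| -> U (p + h *: v + x *: u) /\ U (p + x *: u).
  move=> xh; split; first by rewrite addrAC; exact: Uxy.
  by have := Uxy x 0 xh; rewrite scale0r addr0 normr0; apply.
have [x xh|x xh phiE] := @MVT0 _ phi dphi h.
  have [U1 U2] := Ux _ xh.
  by apply: is_deriveB; apply: is_derive_line; exact: der.
pose chi y := 'D_u f (p + x *: u + y *: v).
have [y yh|y yh chiE] := @MVT0 _ chi
    (fun y => 'D_v (fun q => 'D_u f q) (p + x *: u + y *: v)) h.
  by apply: (@is_derive_line (fun q => 'D_u f q)); apply: der => //; exact: Uxy.
exists x, y; split => //.
rewrite expr2 mulrA -chiE.
have -> : chi h - chi 0 = dphi x.
  by rewrite /chi /dphi scale0r addr0 (addrAC p).
rewrite -phiE /phi !scale0r !addr0 (addrAC p).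
by rewrite opprB addrA [in RHS]addrAC.
Qed.

(** The second difference is symmetric in [u] and [v], so the two mixed derivatives agree at two
    points close to [p]; continuity brings both values to [p]. *)
Lemma schwarz U (f : V -> R) p u v : open U -> smooth_open U f -> U p ->
  'D_v (fun q => 'D_u f q) p = 'D_u (fun q => 'D_v f q) p.
Proof.
move=> oU sf Up; apply/eqP; rewrite -subr_eq0 -normr_le0.
apply/ler_addgt0Pr => e e0; rewrite add0r.
pose C a b := [set q | `|'D_b (fun q => 'D_a f q) p - 'D_b (fun q => 'D_a f q) q|
  <= e / 2].
have cont a b : nbhs p (C a b).
  have sg := smooth_open_derive b (smooth_open_derive a sf).
  have /differentiable_continuous/cvgrPdist_le := smooth_open_differentiable sg Up.
  by apply; rewrite divr_gt0.
have : nbhs p (C u v `&` C v u) by exact: filterI.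
rewrite nbhsE => -[U' [oU' U'p] U'P].
have near2 a b := @near_line2 (U `&` U') p a b (openI oU oU') (conj Up U'p).
near (0 : R)^' => h.
have h0 : h != 0 by near: h; exact: nbhs_dnbhs_neq.
have huv : forall x y : R, `|x| <= `|h| -> `|y| <= `|h| ->
    (U `&` U') (p + x *: u + y *: v).
  by near: h; apply: cvg_within; exact: near2.
have hvu : forall x y : R, `|x| <= `|h| -> `|y| <= `|h| ->
    (U `&` U') (p + x *: v + y *: u).
  by near: h; apply: cvg_within; exact: near2.
have [x [y [xh yh E1]]] := mixed_difference sf (fun x y a b => (huv x y a b).1).
have [x' [y' [xh' yh' E2]]] := mixed_difference sf (fun x y a b => (hvu x y a b).1).
have [+ _] := U'P _ (huv x y xh yh).2.
have [_ +] := U'P _ (hvu x' y' xh' yh').2.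
rewrite /C /=.
have -> : 'D_v (fun q => 'D_u f q) (p + x *: u + y *: v) =
  'D_u (fun q => 'D_v f q) (p + x' *: v + y' *: u).
  apply: (@mulIf R (h ^+ 2)); first exact: expf_neq0.
  apply: (etrans (esym E1)); apply: (etrans _ E2).
  rewrite (addrAC p (h *: v)).
  by rewrite -addrA addrC -!addrA; congr (_ + _); rewrite addrCA addrC -addrA.
set a := 'D_u _ p; set b := 'D_v _ p; set c := 'D_u _ _ => ca cb.
move: ca cb; clearbody a b c => ca cb.
rewrite (_ : b - a = (b - c) - (a - c)); last by ring.
by rewrite (le_trans (ler_normB _ _))// [leRHS]splitr lerD.
Unshelve. all: by end_near. Qed.

Lemma jet2_line U (f : V -> R) p u : open U -> smooth_open U f -> U p ->
  jet2 (fun s => f (p + s *: u))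
    (f p, 'D_u f p, 'D_u (fun q => 'D_u f q) p).
Proof.
move=> oU sf Up.
have der (g : V -> R) q w : smooth_open U g -> U q -> derivable g q w.
  by move=> sg Uq; apply: diff_derivable; exact: smooth_open_differentiable Uq.
have := @jet2_of_derive R (fun s => f (p + s *: u)) (fun s => 'D_u f (p + s *: u))
  ('D_u (fun q => 'D_u f q) p).
rewrite scale0r addr0; apply.
  have := near_line u oU Up; apply: filterS => s Us.
  by apply: is_derive_line; exact: der.
rewrite -[X in is_derive _ _ _ ('D_u _ X)]addr0 -[X in _ + X](scale0r u).
apply: (@is_derive_line (fun q => 'D_u f q)); rewrite scale0r addr0.
by apply: der => //; exact: smooth_open_derive.
Qed.

End Smooth.

(** * The speed as a function of the pinching *)

Section Speed.
Variable R : realType.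

Lemma is_derive_curve (V : normedModType R) (f : V -> R) (g : R -> V) (x : R) (dg : V) :
  differentiable f (g x) -> is_derive x 1 g dg ->
  is_derive x 1 (f \o g) ('D_dg f (g x)).
Proof.
move=> df [/derivable1_diffP dg' dgE].
have dfg : differentiable (f \o g) x by exact: differentiable_comp.
split; first exact/derivable1_diffP.
by rewrite !deriveE// diff_comp//= -dgE deriveE.
Qed.

Lemma is_derive_pair (g h : R -> R) (x dg dh : R) :
  is_derive x 1 g dg -> is_derive x 1 h dh ->
  is_derive x 1 (fun t => (g t, h t)) (dg, dh).
Proof.
move=> [/derivable1_diffP dg' dgE] [/derivable1_diffP dh' dhE].
have dgh := differentiable_pair dg' dh'.
split; first exact/derivable1_diffP.
by rewrite deriveE// diff_pair//= -dgE -dhE !deriveE.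
Qed.

Variable F : R -> R -> R.
Hypothesis hF : admissible_speed F.

(* The larger of the two numbers with sum 1 and product 1 / c. *)
Definition kappa_max (c : R) : R := (1 + Num.sqrt (1 - 4 / c)) / 2.
Definition psi (c : R) : R := F (kappa_max c) (1 - kappa_max c).

Lemma kappa_maxE (a b : R) : 0 < b -> b <= a -> kappa_max ((a + b) ^+ 2 / (a * b)) = a
  / (a + b).
Proof.
move=> b0 ba; have a0 : 0 < a by exact: lt_le_trans ba.
have s0 : 0 < a + b by exact: addr_gt0.
have [an bn sn] : [/\ a != 0, b != 0 & a + b != 0] by split; rewrite gt_eqF.
rewrite /kappa_max (_ : 1 - _ = ((a - b) / (a + b)) ^+ 2); last first.
  by field; rewrite sn an bn.
rewrite sqrtr_sqr ger0_norm; first by field.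
by rewrite divr_ge0 ?subr_ge0// ltW.
Qed.

(** Homogeneity scales the arguments to sum 1, where their product determines them up to order, and
    symmetry makes the order irrelevant. *)
Lemma speed_psi (a b : R) : 0 < a -> 0 < b ->
  F a b = (a + b) * psi ((a + b) ^+ 2 / (a * b)).
Proof.
case: hF => _ Fsym Fhom _ _.
wlog ba : a b / b <= a => [H a0 b0|a0 b0].
  have [/H|/ltW/H] := leP b a; first exact.
  by rewrite Fsym// addrC [b * a]mulrC; exact.
have s0 : 0 < a + b by exact: addr_gt0.
rewrite /psi kappa_maxE// -Fhom//.
- by congr (F _ _); field; rewrite gt_eqF.
- exact: divr_gt0.
- by rewrite subr_gt0 ltr_pdivrMr// mul1r ltrDl.
Qed.

(** [F1] and [F2] are the partial derivatives of [F] at [(a, b)]. The value of [psi] is Euler's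
    relation; its derivative is that of [F] along the curve [(kappa_max c, 1 - kappa_max c)].
    Strictness of [b < a] keeps the square root away from 0. *)
Lemma psi_derive_lt (a b : R) : 0 < b -> b < a -> a + b = 1 ->
  exists F1 F2 : R, [/\ 0 < F1, 0 < F2, psi (a * b)^-1 = a * F1 + b * F2 &
    is_derive (a * b)^-1 1 psi ((F1 - F2) * ((a * b) ^+ 2 / (a - b)))].
Proof.
move=> b0 ba ab1; have a0 : 0 < a by exact: lt_trans ba.
case: hF => sF Fsym Fhom Fmon _.
pose f (p : R * R) := F p.1 p.2.
have df : differentiable f (a, b) by exact: (sF [::] (a, b) (conj a0 b0)).
have [F1_gt0 F2_gt0] := Fmon a b a0 b0.
have dsum u v : 'D_(u, v) f (a, b) = u * 'D_(1, 0) f (a, b) + v * 'D_(0, 1) f (a, b).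
  rewrite !deriveE//.
  have -> : (u, v) = u *: (1, 0) + v *: (0, 1) :> R * R.
    by congr (_, _); rewrite /= /GRing.scale /= !(mulr0, mulr1, addr0, add0r).
  by rewrite linearD !linearZ.
have F1E : derive1 (F^~ b) a = 'D_(1, 0) f (a, b).
  rewrite derive1E; apply: derive_val.
  apply: (@is_derive_curve _ f (fun t => (t, b)) a (1, 0) df).
  exact: is_derive_pair.
have F2E : derive1 (F a) b = 'D_(0, 1) f (a, b).
  rewrite derive1E; apply: derive_val.
  apply: (@is_derive_curve _ f (fun t => (a, t)) b (0, 1) df).
  exact: is_derive_pair.
exists (derive1 (F^~ b) a), (derive1 (F a) b); split => //.
- have -> : psi (a * b)^-1 = F a b.
    by rewrite speed_psi// ab1 expr1n !mul1r.
  rewrite F1E F2E -dsum.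
  (* Euler's relation comes from differentiating [F (t * a) (t * b) = t * F a b] at [t = 1]. *)
  pose g (t : R) : R * R := (t * a, t * b).
  have dg : is_derive (1 : R) 1 g (a, b).
    apply: is_derive_pair.
      by apply: is_derive_eq; rewrite /GRing.scale /= mulr0 mulr1 add0r.
    by apply: is_derive_eq; rewrite /GRing.scale /= mulr0 mulr1 add0r.
  have g1 : g 1 = (a, b) by rewrite /g !mul1r.
  have dfg1 : differentiable f (g 1) by rewrite g1.
  have [_] := is_derive_curve dfg1 dg; rewrite g1 => <-.
  rewrite -[LHS](@derive_val R R R 1 1 (fun t : R => t * F a b)); last first.
    by apply: is_derive_eq; rewrite /GRing.scale /= mulr0 mulr1 add0r.
  apply: near_eq_derive; near=> t.
  by rewrite /= /f /g /= Fhom//; near: t; exact: lt_nbhsr.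
- rewrite F1E F2E.
  have kE : kappa_max (a * b)^-1 = a.
    by have := kappa_maxE b0 (ltW ba); rewrite ab1 expr1n mul1r divr1.
  have dk : is_derive (a * b)^-1 1 kappa_max ((a * b) ^+ 2 / (a - b)).
    rewrite /kappa_max.
    have ab0 : a * b != 0 by rewrite mulf_neq0 ?gt_eqF.
    have abi0 : (a * b)^-1 != 0 by rewrite invr_eq0.
    have sq : 1 - 4 / (a * b)^-1 = (a - b) ^+ 2.
      by transitivity ((a + b) ^+ 2 - 4 * (a * b)); [rewrite invrK ab1 expr1n|ring].
    have d1 : is_derive (a * b)^-1 1 (fun c : R => 1 - 4 / c) (4 * (a * b) ^+ 2).
      have dV := @is_deriveV R id (a * b)^-1 1 1 abi0 (is_derive_id _ _).
      have dB := is_deriveB (is_derive_cst (1 : R) (a * b)^-1 1) (is_deriveZ 4 dV).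
      apply: (is_derive_eq dB).
      by rewrite /GRing.scale /= mulr1 exprVn invrK sub0r mulrN opprK.
    have sq0 : 0 < 1 - 4 / (a * b)^-1 by rewrite sq exprn_gt0 ?subr_gt0.
    have d2 := @is_derive1_comp R Num.sqrt (fun c : R => 1 - 4 / c) _ _ _
      (is_derive1_sqrt sq0) d1.
    have d3 : is_derive (a * b)^-1 1 (fun c => 2^-1 * (1 + Num.sqrt (1 - 4 / c)))
      (2^-1 * (0 + (2 * Num.sqrt (1 - 4 / (a * b)^-1))^-1 * (4 * (a * b) ^+ 2))).
      exact: (is_deriveZ 2^-1 (is_deriveD (is_derive_cst (1 : R) (a * b)^-1 1) d2)).
    rewrite (_ : (fun c => _) = (fun c => 2^-1 * (1 + Num.sqrt (1 - 4 / c)))); last first.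
      by apply/funext => c; rewrite mulrC.
    apply: is_derive_eq d3 _.
    rewrite sq sqrtr_sqr ger0_norm ?subr_ge0 ?ltW// add0r; field.
    by rewrite subr_eq0 gt_eqF.
  pose g (t : R) : R * R := (kappa_max t, 1 - kappa_max t).
  have gE : g (a * b)^-1 = (a, b) by rewrite /g kE -ab1 addrC addKr.
  have dfg : differentiable f (g (a * b)^-1) by rewrite gE.
  set d := _ / (a - b) in dk *.
  have dg : is_derive (a * b)^-1 1 g (d, - d).
    apply: is_derive_pair => //.
    apply: (is_derive_eq (is_deriveB (is_derive_cst (1 : R) (a * b)^-1 1) dk)).
    by rewrite sub0r.
  have := is_derive_curve dfg dg; rewrite gE dsum mulNr -mulrBr [d * _]mulrC.
  exact.
Unshelve. all: by end_near. Qed.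

(** The last two quantities are the partial derivatives of [F] at [(l, m) / (l + m)], and will be
    the coefficients of the second derivatives in the evolution. Only the product is assumed
    positive because [l] and [m] will be components along the outward normal, that is, negatives of
    curvatures. *)
Lemma psi_derive (l m : R) : 0 < l * m -> l != m ->
  let c := (l + m) ^+ 2 / (l * m) in
  exists Q, [/\ is_derive c 1 psi Q, 0 < psi c,
    0 < psi c + Q * (l + m) ^+ 2 * (l - m) / (l ^+ 2 * m) &
    0 < psi c - Q * (l + m) ^+ 2 * (l - m) / (l * m ^+ 2)].
Proof.
(* This says [|m| < |l|]; exchanging [l] and [m] exchanges the last two claims. *)
wlog lm : l m / 0 < (l - m) * (l + m) => [H lm0 lDm|].
  have s0 : (l - m) * (l + m) != 0.
    rewrite mulf_neq0 ?subr_eq0//; apply/eqP => S.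
    by move: lm0; rewrite (_ : l = - m) ?mulNr ?oppr_gt0 -?expr2 ?ltNge ?sqr_ge0//; lra.
  have [/H|] := ltP 0 ((l - m) * (l + m)); first exact.
  rewrite le_eqVlt (negPf s0) /= => s1.
  have s2 : 0 < (m - l) * (m + l) by rewrite -opprB mulNr oppr_gt0 [m + l]addrC.
  have ml0 : 0 < m * l by rewrite mulrC.
  have mDl : m != l by rewrite eq_sym.
  have /= := H _ _ s2 ml0 mDl; rewrite (addrC m l) (mulrC m l) => -[Q [dQ P0 p1 p2]].
  have [l0 m0] : l != 0 /\ m != 0.
    by have := gt_eqF lm0; move/negbT; rewrite mulf_eq0 negb_or => /andP.
  exists Q; split => //.
  - rewrite (_ : _ * (l - m) / _ = - (Q * (l + m) ^+ 2 * (m - l) / (m * l ^+ 2)))//.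
    by field; rewrite l0 m0.
  - rewrite (_ : _ * (l - m) / _ = - (Q * (l + m) ^+ 2 * (m - l) / (m ^+ 2 * l)))
    ?opprK//.
    by field; rewrite l0 m0.
move=> lm0 _ c.
have lmN0 : l * m != 0 by rewrite gt_eqF.
have [l0 m0] : l != 0 /\ m != 0 by move: lmN0; rewrite mulf_eq0 negb_or => /andP.
have s0 : l + m != 0 by apply/eqP => s0; move: lm; rewrite s0 mulr0 ltxx.
have d0 : l - m != 0 by apply/eqP => s; move: lm; rewrite s mul0r ltxx.
have s2 : 0 < (l + m) ^+ 2 by rewrite exprn_even_gt0.
pose a := l / (l + m); pose b := m / (l + m).
have ab1 : a + b = 1 by rewrite /a /b; field.
have ab0 : 0 < a * b.
  by rewrite (_ : a * b = l * m / (l + m) ^+ 2) ?divr_gt0// /a /b; field.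
have ba : b < a.
  by rewrite -subr_gt0 (_ : a - b = (l - m) * (l + m) / (l + m) ^+ 2) ?divr_gt0// /a
    /b; field.
have b0 : 0 < b.
  rewrite ltNge; apply/negP => b0; have a0 : 0 < a by lra.
  by move: ab0; rewrite pmulr_rgt0// ltNge b0.
have [F1 [F2 [F10 F20]]] := psi_derive_lt b0 ba ab1.
have -> : (a * b)^-1 = c by rewrite /c /a /b; field; rewrite s0 l0 m0.
move=> PE dQ; have a0 : 0 < a by exact: lt_trans ba.
exists ((F1 - F2) * ((a * b) ^+ 2 / (a - b))); split => //.
- by rewrite PE addr_gt0// mulr_gt0.
- rewrite (_ : _ + _ = F1)// PE -[RHS]mulr1 -ab1 /a /b; field.
  by rewrite s0 m0 l0 d0.
- rewrite (_ : _ - _ = F2)// PE -[RHS]mulr1 -ab1 /a /b; field.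
  by rewrite s0 m0 l0 d0.
Qed.

End Speed.

(* These polynomials are evaluated both on real numbers and on 2-jets, hence the
   abstract operations.  The argument x lists the vectors
   X_1, X_2, X_11, X_12, X_22 by their coordinates; then first_of and
   second_of yield g_ij and L_ij = <X_ij, N> (at indices 0, 1 and 2, 3, 4) for the
   normal N = X_1 x X_2, which is not normalized, and mean_of, gram_of and gauss_of are
   det g tr (g^-1 L), det g and det L. *)
Section FundamentalForms.
Variables (T : Type) (add sub mul : T -> T -> T).
Implicit Types (u v : nat -> T) (x : nat -> nat -> T).

Definition dot3 u v : T :=
  add (add (mul (u 0%N) (v 0%N)) (mul (u 1%N) (v 1%N))) (mul (u 2%N) (v 2%N)).
Definition cross3 u v (k : nat) : T :=
  match k with
  | 0 => sub (mul (u 1%N) (v 2%N)) (mul (u 2%N) (v 1%N))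
  | 1 => sub (mul (u 2%N) (v 0%N)) (mul (u 0%N) (v 2%N))
  | _ => sub (mul (u 0%N) (v 1%N)) (mul (u 1%N) (v 0%N))
  end.
Definition normal_of x := cross3 (x 0%N) (x 1%N).
Definition second_of x i := dot3 (x i) (normal_of x).
Definition first_of x i j := dot3 (x i) (x j).
Definition mean_of x :=
  sub (add (mul (first_of x 1 1) (second_of x 2)) (mul (first_of x 0 0) (second_of x 4)))
      (add (mul (first_of x 0 1) (second_of x 3)) (mul (first_of x 0 1) (second_of x 3))).
Definition gram_of x := sub (mul (first_of x 0 0) (first_of x 1 1)) (mul (first_of x 0
  1) (first_of x 0 1)).
Definition gauss_of x := sub (mul (second_of x 2) (second_of x 4)) (mul (second_of x 3)
  (second_of x 3)).
(* With a = l m and b = (l + m)^2 this is nonpositive iff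
   (k1 + k2)^2 / (k1 k2) <= (l + m)^2 / (l m). *)
Definition defect_of (a b : T) x :=
  sub (mul a (mul (mean_of x) (mean_of x))) (mul b (mul (gram_of x) (gauss_of x))).
End FundamentalForms.

Definition seq5 (T : Type) (a b c d e : T) (i : nat) : T :=
  match i with 0 => a | 1 => b | 2 => c | 3 => d | _ => e end.

Local Notation jet R := (R * R * R)%type.
Local Notation add := (fun a b : Real.sort _ => a + b).
Local Notation sub := (fun a b : Real.sort _ => a - b).
Local Notation mul := (fun a b : Real.sort _ => a * b).
Local Notation N_ := (normal_of sub mul).
Local Notation A_ := (mean_of add sub mul).
Local Notation D_ := (gram_of add sub mul).
Local Notation M_ := (gauss_of add sub mul).
Local Notation Phi_ := (defect_of add sub mul).
Local Notation jN := (normal_of (@jsub _) (@jmul _)).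
Local Notation jA := (mean_of (@jadd _) (@jsub _) (@jmul _)).
Local Notation jD := (gram_of (@jadd _) (@jsub _) (@jmul _)).
Local Notation jM := (gauss_of (@jadd _) (@jsub _) (@jmul _)).
Local Notation jPhi a b :=
  (defect_of (@jadd _) (@jsub _) (@jmul _) (jcst a) (jcst b)).

(** * The evolution identity on jets *)

Section JetIdentities.
Variable R : realType.

Section FormJets.
Variables (x : R -> nat -> nat -> R) (jx : nat -> nat -> jet R).
Hypothesis xj : forall i k, jet2 (fun s => x s i k) (jx i k).

Let jet2S (f g : R -> R) j k : jet2 f j -> jet2 g k -> jet2 (fun s => f s - g s) (jsub
  j k).
Proof. exact: jet2B. Qed.

Lemma jet2_normal k : jet2 (fun s => N_ (x s) k) (jN jx k).
Proof. by case: k => [|[|k]]; apply: jet2S; apply: jet2M; exact: xj. Qed.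

Let jet2_dot u v ju jv : (forall k, jet2 (fun s : R => u s k) (ju k)) ->
  (forall k, jet2 (fun s => v s k) (jv k)) ->
  jet2 (fun s => dot3 add mul (u s) (v s)) (dot3 (@jadd R) (@jmul R) ju jv).
Proof.
by move=> uj vj; apply: jet2D; [apply: jet2D|]; apply: jet2M.
Qed.

Let jet2_second i : jet2 (fun s => second_of add sub mul (x s) i)
  (second_of (@jadd R) (@jsub R) (@jmul R) jx i).
Proof. by apply: jet2_dot => k; [exact: xj|exact: jet2_normal]. Qed.

Let jet2_first i j : jet2 (fun s => first_of add mul (x s) i j)
  (first_of (@jadd R) (@jmul R) jx i j).
Proof. by apply: jet2_dot => k; exact: xj. Qed.

Lemma jet2_mean : jet2 (fun s => A_ (x s)) (jA jx).
Proof.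
exact: (jet2S (jet2D (jet2M (jet2_first _ _) (jet2_second _)) (jet2M (jet2_first _ _)
  (jet2_second _)))
  (jet2D (jet2M (jet2_first _ _) (jet2_second _)) (jet2M (jet2_first _ _) (jet2_second
    _)))).
Qed.

Lemma jet2_gram : jet2 (fun s => D_ (x s)) (jD jx).
Proof.
exact: (jet2S (jet2M (jet2_first _ _) (jet2_first _ _)) (jet2M (jet2_first _ _)
  (jet2_first _ _))).
Qed.

Lemma jet2_gauss : jet2 (fun s => M_ (x s)) (jM jx).
Proof.
exact: (jet2S (jet2M (jet2_second _) (jet2_second _)) (jet2M (jet2_second _)
  (jet2_second _))).
Qed.

Lemma jet2_defect a b : jet2 (fun s => Phi_ a b (x s)) (jPhi a b jx).
Proof.
exact: (jet2S (jet2M (jet2_cst a) (jet2M jet2_mean jet2_mean))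
  (jet2M (jet2_cst b) (jet2M jet2_gram jet2_gauss))).
Qed.

End FormJets.

Definition vec3 (a b c : R) (k : nat) : R :=
  match k with 0 => a | 1 => b | _ => c end.

Definition jline (u v w : nat -> R) (k : nat) : jet R := (u k, v k, w k).

(** The jet of [velocity] at a critical point of the pinching: [P] is the value of psi, and
    [Q' * phi2] is the second order coefficient of psi along the pinching, where [phi2] is that of
    the defect. *)
Definition jvelocity (P Q' : R) (jx : nat -> nat -> jet R) (phi2 : R) k : jet R :=
  jmul (jmul (jA jx) (P, 0, Q' * phi2))
    (jmul (jmul (jinv (jD jx)) (jinv (jD jx))) (jN jx k)).

Section AdaptedJets.
Variables (l m : R) (p1 p2 q1 q2 r1 r2 : R).
Variables (a1 a2 a3 b1 b2 b3 c1 c2 c3 d1 d2 d3 : R).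
Variables (y1111 y1112 y1122 y1222 y2222 : nat -> R).
Let X1 := vec3 1 0 0. Let X2 := vec3 0 1 0.
Let X11 := vec3 p1 p2 l. Let X12 := vec3 q1 q2 0. Let X22 := vec3 r1 r2 m.
Let X111 := vec3 a1 a2 a3. Let X112 := vec3 b1 b2 b3.
Let X122 := vec3 c1 c2 c3. Let X222 := vec3 d1 d2 d3.
(* Jets of X_1, X_2, X_11, X_12, X_22 along the two coordinate lines and along
   the time axis, in coordinates that are adapted at the base point:
   X_1, X_2, nu are orthonormal and X_12 has no normal component. *)
Definition line1 := seq5 (jline X1 X11 X111) (jline X2 X12 X112)
  (jline X11 X111 y1111) (jline X12 X112 y1112) (jline X22 X122 y1122).
Definition line2 := seq5 (jline X1 X12 X122) (jline X2 X22 X222)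
  (jline X11 X112 y1122) (jline X12 X122 y1222) (jline X22 X222 y2222).
Notation Phi := (jPhi (l * m) ((l + m) ^+ 2)).

Ltac unf := rewrite /jvelocity /line1 /line2 /defect_of /mean_of /gram_of /gauss_of
  /second_of /first_of /dot3 /normal_of /cross3 /seq5 /=
  /jline /= /X1 /X2 /X11 /X12 /X22 /X111 /X112 /X122 /X222 /vec3 /=
  /jsub /jinv /jmul /jadd /jopp /jcst /=.

Lemma defect_jet_value : (Phi line1).1.1 = 0 /\ (Phi line2).1.1 = 0.
Proof. by split; unf; ring. Qed.

Lemma gram_gauss_line1 : (jD line1).1.1 = 1 /\ (jM line1).1.1 = l * m.
Proof. by split; unf; ring. Qed.

Lemma gram_gauss_line2 : (jD line2).1.1 = 1 /\ (jM line2).1.1 = l * m.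
Proof. by split; unf; ring. Qed.

(** The last factor is m h_11;1 - l h_22;1: the terms with [p1], [r1] and [q2] are the Christoffel
    and normal derivative corrections that make the third derivatives covariant. *)
Lemma defect_jet_line1 : (Phi line1).1.2 =
  (l + m) * (l - m) * (m * (a3 - 3 * l * p1) - l * (c3 - l * r1 - 2 * m * q2)).
Proof. unf; ring. Qed.

Lemma defect_jet_line2 : (Phi line2).1.2 =
  (l + m) * (l - m) * (m * (b3 - 2 * l * q1 - m * p2) - l * (d3 - 3 * m * r2)).
Proof. unf; ring. Qed.

Variables (V1 V2 V11 V12 V22 : nat -> R) (z : nat -> nat -> R).
Definition tline := seq5 (jline X1 V1 (z 0)) (jline X2 V2 (z 1))
  (jline X11 V11 (z 2)) (jline X12 V12 (z 3)) (jline X22 V22 (z 4)).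

Lemma jet_value_tline : [/\ (Phi tline).1.1 = 0, (jD tline).1.1 = 1 &
  (jM tline).1.1 = l * m].
Proof. by split; rewrite /tline; unf; ring. Qed.

(** [V12] is absent because it is multiplied by the off-diagonal entries of the two fundamental
    forms, which vanish at the base point. Hence the velocity is needed along the two lines only. *)
Lemma defect_jet_tline : (Phi tline).1.2 = (l + m) * (l - m) *
  (m * (V11 2 - p1 * V1 2 - p2 * V2 2 - 2 * l * V1 0) -
   l * (V22 2 - r1 * V1 2 - r2 * V2 2 - 2 * m * V2 1)).
Proof. rewrite /tline; unf; ring. Qed.

End AdaptedJets.

(** Eliminating the inverses of the Gram determinant leaves polynomials, so that [ring] can check
    the evolution identity. *)
Lemma jvelocityE P Q' jx f k : (jD jx).1.1 = 1 -> let a := jA jx in let d := jD jx in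
  let n := jN jx k in jvelocity P Q' jx f k =
  (P * (a.1.1 * n.1.1),
   P * (a.1.2 * n.1.1 + a.1.1 * n.1.2 - 2 * d.1.2 * a.1.1 * n.1.1),
   P * (a.2 * n.1.1 + 2 * a.1.2 * n.1.2 + a.1.1 * n.2
        - 4 * d.1.2 * (a.1.2 * n.1.1 + a.1.1 * n.1.2)
        + a.1.1 * n.1.1 * (6 * d.1.2 ^+ 2 - 2 * d.2))
   + Q' * f * (a.1.1 * n.1.1)).
Proof.
rewrite /jvelocity; case: (jA jx) (jD jx) (jN jx k) => [[A0 A1] A2] [[D0 D1] D2] [[n0
  n1] n2] /= ->.
by rewrite /jmul /jinv /= !expr1n invr1; congr (_, _, _); field.
Qed.

Ltac unfold_jets := rewrite /jvelocity /line1 /line2 /defect_of /mean_of /gram_of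
  /gauss_of /second_of /first_of /dot3
  /normal_of /cross3 /seq5 /= /jline /= /vec3 /= /jsub /jinv /jmul /jadd /jopp /jcst /=.

Section Evolution.
(* The third derivatives a3, b3, c3, d3 in the direction of nu are those for which
   h_11;1 = lam l, h_22;1 = lam m, h_11;2 = mu l and h_22;2 = mu m, which is what
   the vanishing of both space derivatives of the defect amounts to. *)
Variables (l m lam mu P Q' : R) (p1 p2 q1 q2 r1 r2 a1 a2 b1 b2 c1 c2 d1 d2 : R).
Variables (y1111 y1112 y1122 y1222 y2222 V12 : nat -> R) (z : nat -> nat -> R).
Let a3 := 3 * l * p1 + lam * l.
Let b3 := 2 * l * q1 + m * p2 + mu * l.
Let c3 := l * r1 + 2 * m * q2 + lam * m.
Let d3 := 3 * m * r2 + mu * m.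
Let ln1 := line1 l m p1 p2 q1 q2 r1 r2 a1 a2 a3 b1 b2 b3 c1 c2 c3
   y1111 y1112 y1122.
Let ln2 := line2 l m p1 p2 q1 q2 r1 r2 b1 b2 b3 c1 c2 c3 d1 d2 d3
   y1122 y1222 y2222.
Let Phi := jPhi (l * m) ((l + m) ^+ 2).
Let f1 := (Phi ln1).2.
Let f2 := (Phi ln2).2.
Let J1 := jvelocity P Q' ln1 f1.
Let J2 := jvelocity P Q' ln2 f2.

(** For [Q' = Q / (l * m) ^+ 2] the coefficients of [f1] and [f2] are the two positive numbers of
    [psi_derive]. The last term is the gradient term; its sign is favorable as [P] is positive. *)
Lemma defect_evolution : (Phi (tline l m p1 p2 q1 q2 r1 r2 (fun k => (J1 k).1.2)
   (fun k => (J2 k).1.2) (fun k => (J1 k).2) V12 (fun k => (J2 k).2) z)).1.2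
 = (P + Q' * (l + m) ^+ 2 * (l - m) * m) * f1
   + (P - Q' * (l + m) ^+ 2 * (l - m) * l) * f2
   - 2 * P * (l + m) ^+ 2 * ((lam * m) ^+ 2 + (mu * l) ^+ 2).
Proof.
rewrite /Phi defect_jet_tline.
have d1E : (jD ln1).1.1 = 1.
  by rewrite /ln1; unfold_jets; ring.
have d2E : (jD ln2).1.1 = 1.
  by rewrite /ln2; unfold_jets; ring.
rewrite /J1 /J2 !jvelocityE//=.
rewrite /f1 /f2 /Phi /ln1 /ln2.
unfold_jets; rewrite /a3 /b3 /c3 /d3.
ring.
Qed.
End Evolution.
End JetIdentities.

(** * The contradiction at a maximum, in terms of jets *)

Section MaximumPrinciple.
Variable R : realType.

(* This is - F(k1, k2) nu, whatever the side to which N = X_1 x X_2 points. *)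
Definition velocity (psi : R -> R) (x : nat -> nat -> R) (k : nat) : R :=
  A_ x * psi (A_ x * A_ x / (D_ x * M_ x)) * ((D_ x)^-1 * (D_ x)^-1 * N_ x k).

(** The pinching A^2 / (D M) equals b / a + Phi / (a D M), where Phi is the defect. As Phi vanishes
    to first order and D M = a at the base point, its jet is [(b / a, 0, f / a ^+ 2)]. *)
Lemma jet2_speed (psi fA fD fM fN : R -> R) (jA' jM' jN' : jet R) (a b Q d1 d2 f : R) :
  jet2 fA jA' -> jet2 fD (1, d1, d2) -> jet2 fM jM' -> jet2 fN jN' ->
  jet2 (fun s => a * (fA s * fA s) - b * (fD s * fM s)) (0, 0, f) ->
  a != 0 -> jM'.1.1 = a -> is_derive (b / a) 1 psi Q ->
  jet2 (fun s => fA s * psi (fA s * fA s / (fD s * fM s)) *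
                 ((fD s)^-1 * (fD s)^-1 * fN s))
    (jmul (jmul jA' (psi (b / a), 0, Q / a ^+ 2 * f))
      (jmul (jmul (jinv (1, d1, d2)) (jinv (1, d1, d2))) jN')).
Proof.
case: jM' => [[m0 m1] m2] Aj Dj Mj Nj Pj a0 /= m0E dpsi.
rewrite {}m0E in Mj *; have jDV := jet2V Dj (oner_neq0 _).
have jDM := jet2M Dj Mj; rewrite /jmul /= mul1r in jDM.
have jG : jet2 (fun s => fA s * fA s / (fD s * fM s)) (b / a, 0, f / a ^+ 2).
  have := jet2D (jet2_cst (b / a)) (jet2M (jet2M Pj (jet2V jDM a0)) (jet2_cst a^-1)).
  have -> : jadd (jcst (b / a)) (jmul (jmul (0, 0, f)
      (jinv (a, 1 * m1 + d1 * a, 1 * m2 + 2 * d1 * m1 + d2 * a))) (jcst a^-1))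
      = (b / a, 0, f / a ^+ 2).
    by rewrite /jadd /jmul /jinv /jcst /=; congr (_, _, _); field.
  apply: jet2_near.
  have DMn0 : \forall s \near (0 : R), fD s * fM s != 0.
    exact: (jet2_cvg jDM (open_nbhs_nbhs (conj (@open_neq R 0) a0))).
  near=> s; have : fD s * fM s != 0 by near: s.
  move: (fA s) (fD s * fM s) => A' E E0.
  by field; rewrite ?a0 ?E0.
have := jet2M (jet2M Aj (jet2_comp jG dpsi)) (jet2M (jet2M jDV jDV) Nj).
by rewrite [Q / a ^+ 2 * f]mulrAC -[Q * f / _]mulrA.
Unshelve. all: by end_near. Qed.

Lemma jet2_velocity (psi : R -> R) (x : R -> nat -> nat -> R)
    (jx : nat -> nat -> jet R) (a b Q : R) :
  (forall i k, jet2 (fun s => x s i k) (jx i k)) ->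
  a != 0 -> (jD jx).1.1 = 1 -> (jM jx).1.1 = a ->
  (jPhi a b jx).1.1 = 0 -> (jPhi a b jx).1.2 = 0 ->
  is_derive (b / a) 1 psi Q ->
  forall k, jet2 (fun s => velocity psi (x s) k)
    (jvelocity (psi (b / a)) (Q / a ^+ 2) jx (jPhi a b jx).2 k).
Proof.
move=> xj a0 + Ma + + dpsi k; have jP := jet2_defect xj a b.
have jDx := jet2_gram xj; rewrite /jvelocity; move: jDx jP.
case: (jD jx) (jPhi a b jx) => [[d0 d1] d2] [[u v] w] /= jDx jP d01 u0 v0.
rewrite {}d01 {}u0 {}v0 in jDx jP *.
exact: (jet2_speed (jet2_mean xj) jDx (jet2_gauss xj) (jet2_normal xj k) jP a0 Ma dpsi).
Qed.

Section Contradiction.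
Variables (psi : R -> R) (l m Q e : R) (p1 p2 q1 q2 r1 r2 : R).
Variables (a1 a2 a3 b1 b2 b3 c1 c2 c3 d1 d2 d3 : R).
Variables (y1111 y1112 y1122 y1222 y2222 : nat -> R).
Variables (V V1 V2 V11 V12 V22 : nat -> R) (z : nat -> nat -> R).
Variables (x1 x2 xt : R -> nat -> nat -> R) (v1 v2 : R -> nat -> R).
Notation Phi x := (Phi_ (l * m) ((l + m) ^+ 2) x).
Notation P := (psi ((l + m) ^+ 2 / (l * m))).

(** [x1], [x2], [xt] stand for the five derivative vectors along the two principal lines and the
    time axis, [v1], [v2] for the velocity along the lines. The last hypothesis is multiplied by D M
    in order to stay polynomial. *)
Lemma no_interior_max :
  0 < l * m -> l != m ->
  is_derive ((l + m) ^+ 2 / (l * m)) 1 psi Q ->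
  0 < P -> 0 < P + Q * (l + m) ^+ 2 * (l - m) / (l ^+ 2 * m) ->
  0 < P - Q * (l + m) ^+ 2 * (l - m) / (l * m ^+ 2) ->
  (forall i k, jet2 (fun s => x1 s i k) (line1 l m p1 p2 q1 q2 r1 r2
     a1 a2 a3 b1 b2 b3 c1 c2 c3 y1111 y1112 y1122 i k)) ->
  (forall i k, jet2 (fun s => x2 s i k) (line2 l m p1 p2 q1 q2 r1 r2
     b1 b2 b3 c1 c2 c3 d1 d2 d3 y1122 y1222 y2222 i k)) ->
  (forall i k, jet2 (fun s => xt s i k) (tline l m p1 p2 q1 q2 r1 r2
     V1 V2 V11 V12 V22 z i k)) ->
  (forall k, jet2 (v1^~ k) (V k, V1 k, V11 k)) ->
  (forall k, jet2 (v2^~ k) (V k, V2 k, V22 k)) ->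
  (\forall s \near (0 : R), Phi (x1 s) <= 0 /\
     forall k, v1 s k = velocity psi (x1 s) k) ->
  (\forall s \near (0 : R), Phi (x2 s) <= 0 /\
     forall k, v2 s k = velocity psi (x2 s) k) ->
  0 < e ->
  (\forall s \near (0 : R)^'-,
     Phi (xt s) <= e * s * (D_ (xt s) * M_ (xt s))) ->
  False.
Proof.
move=> lm0 lDm dpsi P0 al0 be0 x1j x2j xtj v1j v2j n1 n2 e0 nt.
have lmN0 : l * m != 0 by rewrite gt_eqF.
have [l0 m0] : l != 0 /\ m != 0 by move: lmN0; rewrite mulf_eq0 negb_or => /andP.
have S0 : (l + m) * (l - m) != 0.
  rewrite mulf_neq0 ?subr_eq0//; apply/eqP => S.
  by move: lm0; rewrite (_ : l = - m) ?mulNr ?oppr_gt0 -?expr2 ?ltNge ?sqr_ge0//; lra.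
set ln1 := line1 _ _ _ _ _ _ _ _ _ _ _ _ _ _ _ _ _ _ _ _ in x1j.
set ln2 := line2 _ _ _ _ _ _ _ _ _ _ _ _ _ _ _ _ _ _ _ _ in x2j.
have [ph1 ph2] : (jPhi (l * m) ((l + m) ^+ 2) ln1).1.1 = 0 /\
  (jPhi (l * m) ((l + m) ^+ 2) ln2).1.1 = 0 by exact: defect_jet_value.
have le1 : \forall s \near (0 : R), Phi (x1 s) <= 0 by apply: filterS n1 => s [].
have le2 : \forall s \near (0 : R), Phi (x2 s) <= 0 by apply: filterS n2 => s [].
have [ph1' f1] := jet2_max (jet2_defect x1j (l * m) ((l + m) ^+ 2)) ph1 le1.
have [ph2' f2] := jet2_max (jet2_defect x2j (l * m) ((l + m) ^+ 2)) ph2 le2.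
have [D1 M1] : (jD ln1).1.1 = 1 /\ (jM ln1).1.1 = l * m by exact: gram_gauss_line1.
have [D2 M2] : (jD ln2).1.1 = 1 /\ (jM ln2).1.1 = l * m by exact: gram_gauss_line2.
pose J1 := jvelocity P (Q / (l * m) ^+ 2) ln1 (jPhi (l * m) ((l + m) ^+ 2) ln1).2.
pose J2 := jvelocity P (Q / (l * m) ^+ 2) ln2 (jPhi (l * m) ((l + m) ^+ 2) ln2).2.
have J1E k : (V k, V1 k, V11 k) = J1 k.
  apply: (jet2_uniq (v1j k)).
  apply: jet2_near (jet2_velocity x1j lmN0 D1 M1 ph1 ph1' dpsi k).
  by apply: filterS n1 => s [].
have J2E k : (V k, V2 k, V22 k) = J2 k.
  apply: (jet2_uniq (v2j k)).
  apply: jet2_near (jet2_velocity x2j lmN0 D2 M2 ph2 ph2' dpsi k).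
  by apply: filterS n2 => s [].
have V1E : V1 = fun k => (J1 k).1.2 by apply/funext => k; rewrite -J1E.
have V11E : V11 = fun k => (J1 k).2 by apply/funext => k; rewrite -J1E.
have V2E : V2 = fun k => (J2 k).1.2 by apply/funext => k; rewrite -J2E.
have V22E : V22 = fun k => (J2 k).2 by apply/funext => k; rewrite -J2E.
(* [lam] and [mu] are the ratios h_11;1 / l and h_22;2 / m; the vanishing first derivatives of the
   defect then give h_22;1 = lam m and h_11;2 = mu l. *)
pose lam := (a3 - 3 * l * p1) / l; pose mu := (d3 - 3 * m * r2) / m.
have a3E : a3 = 3 * l * p1 + lam * l by rewrite /lam; field.
have d3E : d3 = 3 * m * r2 + mu * m by rewrite /mu; field.
have c3E : c3 = l * r1 + 2 * m * q2 + lam * m.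
  move: ph1'; rewrite /ln1 defect_jet_line1 => /eqP.
  rewrite mulf_eq0 (negPf S0) /= subr_eq0 => /eqP h.
  have -> : lam * m = m * (a3 - 3 * l * p1) / l by rewrite /lam; field.
  by rewrite h; field.
have b3E : b3 = 2 * l * q1 + m * p2 + mu * l.
  move: ph2'; rewrite /ln2 defect_jet_line2 => /eqP.
  rewrite mulf_eq0 (negPf S0) /= subr_eq0 => /eqP h.
  have -> : mu * l = l * (d3 - 3 * m * r2) / m by rewrite /mu; field.
  by rewrite -h; field.
have [t0 Dt Mt] := jet_value_tline l m p1 p2 q1 q2 r1 r2 V1 V2 V11 V12 V22 z.
have := defect_evolution l m lam mu P (Q / (l * m) ^+ 2) p1 p2 q1 q2 r1 r2 a1 a2 b1 b2
  c1 c2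
  d1 d2 y1111 y1112 y1122 y1222 y2222 V12 z.
rewrite -a3E -b3E -c3E -d3E -/ln1 -/ln2 -/J1 -/J2 -V1E -V2E -V11E -V22E.
set f1' := (jPhi _ _ ln1).2 in f1 *; set f2' := (jPhi _ _ ln2).2 in f2 * => ev.
have jt := jet2B (jet2_defect xtj (l * m) ((l + m) ^+ 2))
  (jet2M (jet2M (jet2_cst e) (@jet2_id R)) (jet2M (jet2_gram xtj) (jet2_gauss xtj))).
have nt' : \forall s \near (0 : R)^'-,
    Phi (xt s) - e * s * (D_ (xt s) * M_ (xt s)) <= 0.
  by apply: filterS nt => s; rewrite subr_le0.
move: f1' f2' f1 f2 ev => f1' f2' f1 f2 ev; move: t0 Dt Mt ev jt nt'.
move: (jPhi _ _ (tline _ _ _ _ _ _ _ _ _ _ _ _ _ _)) => [[u v] w].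
case: (jD _) (jM _) => [[D0' ?] ?] [[M0' ?] ?] /= -> -> -> -> jt nt'.
(* As D = 1 and M = l m at the base point, this bounds the time derivative of the defect below by
   [e * (l * m)]. *)
have := jet2_left_max jt _ nt'.
rewrite /= !(mul0r, mulr0, addr0, add0r, subr0, mulr1, mul1r) => /(_ (oppr0 _)).
have -> : P + Q / (l * m) ^+ 2 * (l + m) ^+ 2 * (l - m) * m =
  P + Q * (l + m) ^+ 2 * (l - m) / (l ^+ 2 * m) by field; rewrite l0 m0.
have -> : P - Q / (l * m) ^+ 2 * (l + m) ^+ 2 * (l - m) * l =
  P - Q * (l + m) ^+ 2 * (l - m) / (l * m ^+ 2) by field; rewrite l0 m0.
apply/negP; rewrite -ltNge subr_lt0.
apply: (@le_lt_trans _ _ 0); last exact: mulr_gt0.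
rewrite subr_le0 (@le_trans _ _ 0)//.
  by rewrite -(addr0 0) lerD// pmulr_rle0.
by rewrite mulr_ge0 ?addr_ge0 ?sqr_ge0// mulr_ge0 ?sqr_ge0// mulr_ge0// ltW.
Qed.
End Contradiction.

End MaximumPrinciple.

Section IteratedDerivatives.
Variable R : realType.

(* c vs stands for the iterated derivative of the parametrization along vs. *)
Lemma no_interior_max_derivatives (T : eqType) (a b tau : T) (c : seq T -> nat -> R)
    (X : T -> R -> nat -> nat -> R) (V : T -> R -> nat -> R) (psi : R -> R) (e Q : R) :
  let l := c [:: a; a] 2 in let m := c [:: b; b] 2 in
  let P := psi ((l + m) ^+ 2 / (l * m)) in
  let Phi := Phi_ (l * m) ((l + m) ^+ 2) in
  (forall vs ws, perm_eq vs ws -> c vs = c ws) ->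
  (forall vs, c vs = vec3 (c vs 0) (c vs 1) (c vs 2)) ->
  c [:: a] = vec3 1 0 0 -> c [:: b] = vec3 0 1 0 -> c [:: a; b] 2 = 0 ->
  (forall u i k, jet2 (fun s => X u s i k) (seq5
     (jline (c [:: a]) (c [:: u; a]) (c [:: u; u; a]))
     (jline (c [:: b]) (c [:: u; b]) (c [:: u; u; b]))
     (jline (c [:: a; a]) (c [:: u; a; a]) (c [:: u; u; a; a]))
     (jline (c [:: a; b]) (c [:: u; a; b]) (c [:: u; u; a; b]))
     (jline (c [:: b; b]) (c [:: u; b; b]) (c [:: u; u; b; b])) i k)) ->
  (forall u k, jet2 ((V u)^~ k)
     (jline (c [:: tau]) (c [:: u; tau]) (c [:: u; u; tau]) k)) ->
  0 < l * m -> l != m ->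
  is_derive ((l + m) ^+ 2 / (l * m)) 1 psi Q ->
  0 < P -> 0 < P + Q * (l + m) ^+ 2 * (l - m) / (l ^+ 2 * m) ->
  0 < P - Q * (l + m) ^+ 2 * (l - m) / (l * m ^+ 2) ->
  (forall u, u = a \/ u = b -> \forall s \near (0 : R), Phi (X u s) <= 0 /\
     forall k, V u s k = velocity psi (X u s) k) ->
  0 < e ->
  (\forall s \near (0 : R)^'-,
     Phi (X tau s) <= e * s * (D_ (X tau s) * M_ (X tau s))) ->
  False.
Proof.
move=> l m P Phi cperm cvec ca cb cab Xj Vj lm0 lDm dpsi P0 al be nab e0 nt.
have pe (vs ws : seq T) : (forall x : pred T, count x vs = count x ws) -> c vs = c ws.
  by move=> h; apply: cperm; apply/permP.
have c12 : c [:: a; b] = vec3 (c [:: a; b] 0) (c [:: a; b] 1) 0 by rewrite {1}cvec cab.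
(* The jets arrive with the direction of the line in front; these permutations bring the directions
   into the order used by [line1], [line2] and [tline]. *)
have s0 u v : c [:: u; v] = c [:: v; u] by apply: pe => x /=; ring.
have s1 u v : c [:: u; v; v] = c [:: v; v; u] by apply: pe => x /=; ring.
have s2 u v : c [:: u; v; u] = c [:: v; u; u] by apply: pe => x /=; ring.
have s3 u v w : c [:: u; v; w] = c [:: v; w; u] by apply: pe => x /=; ring.
have s4 u v : c [:: u; u; v; v] = c [:: v; v; u; u] by apply: pe => x /=; ring.
have s5 u v : c [:: u; u; v; u] = c [:: v; u; u; u] by apply: pe => x /=; ring.
apply: (@no_interior_max R psi l m Q e (c [:: a; a] 0) (c [:: a; a] 1)
  (c [:: a; b] 0) (c [:: a; b] 1) (c [:: b; b] 0) (c [:: b; b] 1)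
  (c [:: a; a; a] 0) (c [:: a; a; a] 1) (c [:: a; a; a] 2)
  (c [:: a; a; b] 0) (c [:: a; a; b] 1) (c [:: a; a; b] 2)
  (c [:: a; b; b] 0) (c [:: a; b; b] 1) (c [:: a; b; b] 2)
  (c [:: b; b; b] 0) (c [:: b; b; b] 1) (c [:: b; b; b] 2)
  (c [:: a; a; a; a]) (c [:: a; a; a; b]) (c [:: a; a; b; b]) (c [:: a; b; b; b])
  (c [:: b; b; b; b]) (c [:: tau]) (c [:: a; tau]) (c [:: b; tau])
  (c [:: a; a; tau]) (c [:: a; b; tau]) (c [:: b; b; tau])
  (seq5 (c [:: tau; tau; a]) (c [:: tau; tau; b]) (c [:: tau; tau; a; a])
    (c [:: tau; tau; a; b]) (c [:: tau; tau; b; b]))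
  (X a) (X b) (X tau) (V a) (V b)) => //.
- move=> i k; rewrite /line1 -!cvec -c12 -ca -cb; exact: Xj.
- move=> i k; rewrite /line2 -!cvec -c12 -ca -cb.
  have := Xj b i k; rewrite (s0 b a) (s2 b a) (s1 b a) (s4 b a) (s5 b a).
  by rewrite -(s1 a b).
- move=> i k; rewrite /tline -!cvec -c12 -ca -cb.
  by have := Xj tau i k; rewrite (s0 tau a) (s0 tau b) (s1 tau a) (s1 tau b) (s3 tau a b).
- exact: (nab a (or_introl erefl)).
- exact: (nab b (or_intror erefl)).
Qed.

End IteratedDerivatives.

(** * Geometry of a surface in a chart *)

Section Geometry.
Variable R : realType.

Lemma dotE3 (u v : 'rV[R]_3) :
  dot u v = u 0 0 * v 0 0 + u 0 1 * v 0 1 + u 0 2%:R * v 0 2%:R.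
Proof.
rewrite /dot !big_ord_recl big_ord0 addr0 addrA.
by congr (_ + _ + _); congr (_ * _); congr (_ _ _); apply/val_inj.
Qed.

Section Bilinear.
Variable n : nat.
Implicit Types u v w : 'rV[R]_n.

Lemma dotC u v : dot u v = dot v u.
Proof. by apply: eq_bigr => i _; rewrite mulrC. Qed.

Lemma dotDl u v w : dot (u + v) w = dot u w + dot v w.
Proof. by rewrite -big_split; apply: eq_bigr => i _; rewrite mxE mulrDl. Qed.

Lemma dotZl a u v : dot (a *: u) v = a * dot u v.
Proof. by rewrite /dot mulr_sumr; apply: eq_bigr => i _; rewrite mxE mulrA. Qed.

Lemma dotDr u v w : dot w (u + v) = dot w u + dot w v.
Proof. by rewrite !(dotC w) dotDl. Qed.

Lemma dotZr a u v : dot v (a *: u) = a * dot v u.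
Proof. by rewrite !(dotC v) dotZl. Qed.

Lemma dot_ge0 u : 0 <= dot u u.
Proof. by apply: sumr_ge0 => i _; rewrite -expr2 sqr_ge0. Qed.

Lemma dot_eq0 u : (dot u u == 0) = (u == 0).
Proof.
apply/idP/eqP => [|->]; last by rewrite /dot big1// => i _; rewrite mxE mul0r.
rewrite psumr_eq0 => [/allP h|i _]; last by rewrite -expr2 sqr_ge0.
apply/rowP => i; rewrite mxE; apply/eqP.
by have := h i (mem_index_enum _); rewrite -expr2 sqrf_eq0.
Qed.

Lemma dot_delta u i : dot u (delta_mx 0 i) = u 0 i.
Proof.
rewrite /dot (bigD1 i)//= mxE !eqxx mulr1 big1 ?addr0// => j ji.
by rewrite mxE eqxx (negPf ji) mulr0.
Qed.

End Bilinear.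

Definition orthonormal3 (E1 E2 E3 : 'rV[R]_3) :=
  [/\ dot E1 E1 = 1, dot E2 E2 = 1, dot E3 E3 = 1 &
  [/\ dot E1 E2 = 0, dot E1 E3 = 0 & dot E2 E3 = 0]].

Definition coord (E1 E2 E3 u : 'rV[R]_3) : nat -> R :=
  vec3 (dot u E1) (dot u E2) (dot u E3).

(** The matrix with rows [E1], [E2], [E3] has its transpose as a right inverse, hence also as a left
    inverse. *)
Lemma gdot_coord E1 E2 E3 u v : orthonormal3 E1 E2 E3 ->
  dot3 add mul (coord E1 E2 E3 u) (coord E1 E2 E3 v) = dot u v.
Proof.
case=> e11 e22 e33 [e12 e13 e23].
pose M : 'M[R]_3 := \matrix_(i, j) nth E3 [:: E1; E2] i 0 j.
have MMT : M *m M^T = 1%:M.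
  apply/matrixP => i j.
  have -> : (M *m M^T) i j = dot (nth E3 [:: E1; E2] i) (nth E3 [:: E1; E2] j).
    by rewrite !mxE; apply: eq_bigr => k _; rewrite !mxE.
  rewrite mxE; case: i => [[|[|[|//]]] ?]; case: j => [[|[|[|//]]] ?] //=.
  - by rewrite dotC.
  - by rewrite dotC.
  - by rewrite dotC.
have MTM := mulmx1C MMT.
have uE (w : 'rV[R]_3) (k : 'I_3) : (w *m M^T) 0 k = coord E1 E2 E3 w k.
  rewrite mxE (_ : coord _ _ _ _ _ = dot w (nth E3 [:: E1; E2] k)).
    by apply: eq_bigr => j _; rewrite !mxE.
  by case: k => [[|[|[|//]]] ?].
have -> : dot u v = dot (u *m M^T) (v *m M^T).
  have dE (a b : 'rV[R]_3) : dot a b = (a *m b^T) 0 0.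
    by rewrite mxE; apply: eq_bigr => j _; rewrite mxE.
  by rewrite !dE trmx_mul trmxK mulmxA -(mulmxA u) MTM mulmx1.
by rewrite dotE3 !uE.
Qed.

Lemma orthonormal3_delta :
  orthonormal3 (delta_mx 0 0) (delta_mx 0 1) (delta_mx 0 2%:R).
Proof. by split; [..|split]; rewrite dot_delta mxE. Qed.

(* Only the square of tau = <N, n> = +- sqrt (det g) survives, so that no choice of
   orientation is needed. *)
Lemma hypersurface_identities (x : nat -> nat -> R) (n : nat -> R) (a b : R) :
  let g i j := first_of add mul x i j in let h i := - dot3 add mul (x i) n in
  (forall k, n k.+2 = n 2) ->
  dot3 add mul n n = 1 -> dot3 add mul (x 0%N) n = 0 -> dot3 add mul (x 1%N) n = 0 ->
  0 < D_ x ->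
  (a + b) * D_ x = g 1 1 * h 2 - 2 * g 0 1 * h 3 + g 0 0 * h 4 ->
  a * b * D_ x = h 2 * h 4 - h 3 ^+ 2 ->
  [/\ M_ x = a * b * D_ x ^+ 2, A_ x ^+ 2 = (a + b) ^+ 2 * D_ x ^+ 3 &
      forall k, A_ x * ((D_ x)^-1 * (D_ x)^-1 * N_ x k) = - (a + b) * n k].
Proof.
move=> g h n2 n1 n0x n1x D0 HE KE.
pose tau := dot3 add mul (N_ x) n.
have NE k : N_ x k = tau * n k.
  have e (i : nat) (y z : R) : y = y * dot3 add mul n n ->
    y * dot3 add mul n n - z = 0 -> y = z.
    by move=> yE /eqP; rewrite -yE subr_eq0 => /eqP.
  apply: (e k); first by rewrite n1 mulr1.
  (* A double cross product identity; its right-hand side vanishes since [n] is orthogonal to both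
     tangent vectors, so that N is parallel to [n]. *)
  have -> : N_ x k * dot3 add mul n n - tau * n k =
    dot3 add mul (x 1%N) n * cross3 sub mul (x 0%N) n k -
    dot3 add mul (x 0%N) n * cross3 sub mul (x 1%N) n k.
    case: k => [|[|k]]; rewrite ?n2 /tau /dot3 /normal_of /cross3; ring.
  by rewrite n0x n1x !mul0r subrr.
have LE i : second_of add sub mul x i = - tau * h i.
  rewrite /second_of {1}/dot3 !NE /h /dot3; ring.
have DE : D_ x = tau ^+ 2.
  (* Lagrange's identity. *)
  rewrite (_ : D_ x = dot3 add mul (N_ x) (N_ x)).
    by rewrite {1}/dot3 !NE -[RHS]mulr1 -n1 /dot3; ring.
  by rewrite /gram_of /first_of /dot3 /normal_of /cross3; ring.
have t0 : tau != 0 by apply/eqP => t0; move: D0; rewrite DE t0 expr0n ltxx.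
have AE : A_ x = - tau * ((a + b) * D_ x).
  by rewrite HE /mean_of !LE /g /first_of; ring.
have ME : M_ x = tau ^+ 2 * (a * b * D_ x).
  by rewrite KE /gauss_of !LE; ring.
split.
- by rewrite ME DE; ring.
- by rewrite AE DE; ring.
- by move=> k; rewrite AE NE DE; field.
Qed.

(** The determinant of e g e^T. It shows that an orthonormal pair of directions is linearly
    independent. *)
Lemma frame_change (e00 e01 e10 e11 g00 g01 g11 : R) :
  (e00 * (e00 * g00 + e01 * g01) + e01 * (e00 * g01 + e01 * g11)) *
  (e10 * (e10 * g00 + e11 * g01) + e11 * (e10 * g01 + e11 * g11)) -
  (e00 * (e10 * g00 + e11 * g01) + e01 * (e10 * g01 + e11 * g11)) ^+ 2 =
  (e00 * e11 - e01 * e10) ^+ 2 * (g00 * g11 - g01 ^+ 2).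
Proof. ring. Qed.

Lemma rotation_diag (a b d : R) : exists c s : R,
  c ^+ 2 + s ^+ 2 = 1 /\ c * s * (d - a) + (c ^+ 2 - s ^+ 2) * b = 0.
Proof.
have [->|b0] := eqVneq b 0; first by exists 1, 0; split; ring.
pose rho := Num.sqrt ((a - d) ^+ 2 + 4 * b ^+ 2).
have rho2 : rho ^+ 2 = (a - d) ^+ 2 + 4 * b ^+ 2.
  by rewrite sqr_sqrtr// addr_ge0 ?sqr_ge0// mulr_ge0 ?sqr_ge0.
(* [a + u] is the larger eigenvalue of the symmetric matrix with rows (a, b) and (b, d), and (b, u)
   is an eigenvector for it. *)
pose u := (d - a + rho) / 2.
have n0 : 0 < b ^+ 2 + u ^+ 2.
  by rewrite ltr_pwDl ?sqr_ge0// lt0r sqrf_eq0 b0 sqr_ge0.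
have q2 := sqr_sqrtr (ltW n0); set q := Num.sqrt _ in q2.
have q0 : q != 0 by rewrite gt_eqF// sqrtr_gt0.
have uE : u ^+ 2 = u * (d - a) + b ^+ 2 
    by rewrite /u; move: rho rho2 {u n0 q q2 q0} => rho rho2; field: rho2.
exists (b / q), (u / q); split.
  rewrite (_ : _ + _ = (b ^+ 2 + u ^+ 2) / q ^+ 2); last by field.
  by rewrite q2 mulfV// gt_eqF.
rewrite (_ : _ + _ = b * (u * (d - a) + b ^+ 2 - u ^+ 2) / q ^+ 2); last by field.
by rewrite uE subrr mulr0 mul0r.
Qed.

Lemma char_poly2 (W : 'M[R]_2) (a b : R) :
  char_poly W = ('X - a%:P) * ('X - b%:P) -> a + b = \tr W /\ a * b = \det W.
Proof.
move=> e; have := @char_poly_trace _ 2 W isT; have := char_poly_det W.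
rewrite e (_ : _ * _ = 'X^2 - (a + b) *: 'X + (a * b)%:P); last first.
  by rewrite -mul_polyC polyCM polyCD; ring.
rewrite !coefE /= => dW tW; split; last first.
  by rewrite mulr0 subr0 add0r sqrrN expr1n mul1r in dW.
by rewrite mulr1 sub0r addr0 in tW; apply: oppr_inj.
Qed.

Lemma sum2 (V : nmodType) (f : 'I_2 -> V) : \sum_i f i = f 0 + f 1.
Proof. by rewrite big_ord_recl big_ord1; congr (_ + f _); apply/val_inj. Qed.

Lemma det2 (W : 'M[R]_2) : \det W = W 0 0 * W 1 1 - W 0 1 * W 1 0.
Proof.
rewrite (expand_det_row _ 0) sum2 /cofactor !det_mx11 !mxE /= expr0 expr1 mul1r.
rewrite mulrA mulrN1 mulNr; congr (_ * W _ _ - _ * W _ _); exact/val_inj.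
Qed.

Lemma principal_curvatures_trace_det (G H : 'M[R]_2) (a b : R) :
  G \in unitmx ->
  char_poly (invmx G *m H) = ('X - a%:P) * ('X - b%:P) ->
  (a + b) * \det G = G 1 1 * H 0 0 - G 0 1 * H 1 0 - G 1 0 * H 0 1 + G 0 0 * H 1 1 /\
  a * b * \det G = \det H.
Proof.
move=> uG /char_poly2[-> ->]; set W := invmx G *m H.
have HE : H = G *m W by rewrite mulmxA mulmxV// mul1mx.
clearbody W; rewrite {}HE; split; first last.
  by rewrite det_mulmx mulrC.
by rewrite det2 /mxtrace sum2 !mxE !sum2; ring.
Qed.

(** After orthonormalization for g, a rotation diagonalizes h and keeps the frame orthonormal. *)
Lemma orthonormal_frame (g00 g01 g11 h00 h01 h11 : R) :
  0 < g00 -> 0 < g00 * g11 - g01 ^+ 2 ->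
  exists e00 e01 e10 e11 : R,
  [/\ e00 * (e00 * g00 + e01 * g01) + e01 * (e00 * g01 + e01 * g11) = 1,
      e10 * (e10 * g00 + e11 * g01) + e11 * (e10 * g01 + e11 * g11) = 1,
      e00 * (e10 * g00 + e11 * g01) + e01 * (e10 * g01 + e11 * g11) = 0 &
      e00 * (e10 * h00 + e11 * h01) + e01 * (e10 * h01 + e11 * h11) = 0].
Proof.
move=> g0; set D := _ - _ => D0.
pose p := Num.sqrt g00; pose q := Num.sqrt (g00 * D).
have p2 : p ^+ 2 = g00 by rewrite sqr_sqrtr// ltW.
have q2 : q ^+ 2 = g00 * D by rewrite sqr_sqrtr// ltW// mulr_gt0.
have p0 : p != 0 by rewrite gt_eqF// sqrtr_gt0.
have q0 : q != 0 by rewrite gt_eqF// sqrtr_gt0 mulr_gt0.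
(* (u, 0) and (v0, v1) come from Gram-Schmidt. *)
pose u := p^-1; pose v0 := - g01 / q; pose v1 := g00 / q.
have uu : u * u * g00 = 1 by rewrite -p2 /u; field.
have uv : u * (v0 * g00 + v1 * g01) = 0 by rewrite /v0 /v1 /u; field; rewrite p0 q0.
have vv : v0 * (v0 * g00 + v1 * g01) + v1 * (v0 * g01 + v1 * g11) = 1.
  rewrite (_ : _ + _ = g00 * D / q ^+ 2); last by rewrite /v0 /v1 /D; field.
  by rewrite -q2 mulfV// expf_neq0.
have [c [s [cs rot]]] := rotation_diag (u * u * h00) (u * (v0 * h00 + v1 * h01))
  (v0 * (v0 * h00 + v1 * h01) + v1 * (v0 * h01 + v1 * h11)).
set UU := u * u * g00 in uu; set UV := u * (_ + _) in uv; set VV := _ + _ in vv.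
exists (c * u + s * v0), (s * v1), (- s * u + c * v0), (c * v1); split.
- transitivity (c ^+ 2 * UU + 2 * c * s * UV + s ^+ 2 * VV); last first.
    by rewrite uu uv vv mulr0 addr0 !mulr1.
  by rewrite /UU /UV /VV; ring.
- transitivity (s ^+ 2 * UU - 2 * c * s * UV + c ^+ 2 * VV); last first.
    by rewrite uu uv vv mulr0 subr0 !mulr1 addrC.
  by rewrite /UU /UV /VV; ring.
- transitivity (- c * s * UU + (c ^+ 2 - s ^+ 2) * UV + c * s * VV); last first.
    by rewrite uu uv vv; ring.
  by rewrite /UU /UV /VV; ring.
- rewrite -[RHS]rot; ring.
Qed.

End Geometry.

(** * Stereographic charts *)

Section Charts.
Variable R : realType.

Lemma dotE2 (u v : 'rV[R]_2) : dot u v = u 0 0 * v 0 0 + u 0 1 * v 0 1.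
Proof. by rewrite /dot sum2. Qed.

Lemma stereo_sphere s (w : 'rV[R]_2) : sphere2 (stereo s w).
Proof.
have d0 : 1 + dot w w != 0 by rewrite gt_eqF// ltr_wpDr// dot_ge0.
rewrite /sphere2 /= /stereo dotZl dotZr dotE3 !mxE /=.
have : (-1) ^+ s * ((-1) ^+ s) = 1 :> R by rewrite -expr2 -exprM mulnC exprM sqrrN
  !expr1n.
move: ((-1) ^+ s : R) => e e2; rewrite dotE2 in d0 *.
set a := w 0 0 in d0 *; set b := w 0 1 in d0 *.
transitivity ((1 + (a * a + b * b)) ^-1 ^+ 2 * (4 * (a * a + b * b) +
   e * e * (a * a + b * b - 1) ^+ 2)); first by ring.
by rewrite e2; field.
Qed.

(** Projecting from the pole farther from [z] gives [|w| <= 1]. The bound matters for compactness: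
    two squares cover the sphere. *)
Lemma stereo_surj (z : 'rV[R]_3) : sphere2 z ->
  exists s (w : 'rV[R]_2), (forall i, -1 <= w 0 i <= 1) /\ stereo s w = z.
Proof.
rewrite /sphere2 /= dotE3 => z1.
pose s := 0 < z 0 2%:R; pose e : R := (-1) ^+ s.
have e2 : e * e = 1 by rewrite /e -expr2 -exprM mulnC exprM sqrrN !expr1n.
have ez : e * z 0 2%:R <= 0.
  by rewrite /e /s; case: ltP => h; rewrite ?expr1 ?expr0 ?mulN1r ?mul1r ?oppr_le0// ltW.
have d0 : 1 - e * z 0 2%:R != 0 by rewrite gt_eqF// ltr_wpDr// oppr_ge0.
pose w : 'rV[R]_2 := \row_i ((1 - e * z 0 2%:R)^-1 * z 0 (widen_ord (leqnSn 2) i)).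
have w0 : w 0 0 = (1 - e * z 0 2%:R)^-1 * z 0 0.
  by rewrite mxE; congr (_ * z _ _); apply/val_inj.
have w1 : w 0 1 = (1 - e * z 0 2%:R)^-1 * z 0 1.
  by rewrite mxE; congr (_ * z _ _); apply/val_inj.
set z2 := z 0 2%:R in z1 ez d0 w w0 w1 *.
move: w w0 w1 => w w0 w1.
have zE : z 0 0 * z 0 0 + z 0 1 * z 0 1 = (1 - e * z2) * (1 + e * z2).
  by transitivity (1 - e * e * (z2 * z2)); [rewrite e2 mul1r -z1 addrK|ring].
have ww : dot w w = (1 + e * z2) / (1 - e * z2).
  rewrite dotE2 w0 w1; set d := 1 - e * z2 in zE d0 *.
  rewrite (_ : _ + _ = (z 0 0 * z 0 0 + z 0 1 * z 0 1) / d ^+ 2); last by field.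
  by rewrite zE; field.
have ww1 : dot w w <= 1.
  rewrite ww ler_pdivrMr ?mul1r; last by rewrite lt_def d0 subr_ge0 (le_trans ez).
  by rewrite lerD2l (le_trans ez)// oppr_ge0.
exists s, w; split.
  move=> i; rewrite -ler_norml -(@expr_le1 _ 2)// real_normK ?num_real// (le_trans _
    ww1)// /dot (bigD1 i)//= expr2.
  by rewrite lerDl sumr_ge0// => j _; rewrite -expr2 sqr_ge0.
rewrite /stereo ww -/e.
have dE : (1 + (1 + e * z2) / (1 - e * z2))^-1 = (1 - e * z2) / 2.
  by field; rewrite d0 /=; apply/eqP; lra.
apply/rowP => i; rewrite !mxE dE.
case: i => [[|[|[|//]]] hi] /=.
- rewrite w0 (_ : Ordinal hi = 0); last exact/val_inj.
  by field.
- rewrite w1 (_ : Ordinal hi = 1); last exact/val_inj.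
  by field.
- rewrite (_ : Ordinal hi = 2%:R); last exact/val_inj.
  by rewrite -/z2; transitivity (e * e * z2); [field|rewrite e2 mul1r].
Qed.

Lemma derive_slice (W : normedModType R) (V : normedModType R) (g : V * R -> W) (t : R)
  (w e : V) :
  'D_e (fun w' => g (w', t)) w = 'D_(e, 0) g (w, t).
Proof.
rewrite /derive (_ : (fun h : R => _) = (fun h : R => h^-1 *:
  ((g \o shift (w, t)) (h *: (e, 0)) - g (w, t))))//.
apply/funext => h /=; congr (_ *: (g _ - _)).
by congr (_, _); rewrite /= scaler0 add0r.
Qed.

End Charts.

(** * Curvature invariants of an immersion in an arbitrary frame *)

Section Immersion.
Variable R : realType.

(** The first and second derivatives along [e0] and [e1]. These directions are constant, so the
    second derivatives transform bilinearly, without first order terms. *)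
Definition frame5 (a0 a1 a00 a01 a11 : 'rV[R]_3) (e0 e1 : 'rV[R]_2) : nat -> 'rV[R]_3 :=
  let c2 (u v : 'rV[R]_2) := (u 0 0 * v 0 0) *: a00 +
    (u 0 0 * v 0 1 + u 0 1 * v 0 0) *: a01 + (u 0 1 * v 0 1) *: a11 in
  seq5 (e0 0 0 *: a0 + e0 0 1 *: a1) (e1 0 0 *: a0 + e1 0 1 *: a1)
    (c2 e0 e0) (c2 e0 e1) (c2 e1 e1).

(** Multiplied by [dot u u], the determinant is the squared length of a nonzero combination of [u]
    and [v], orthogonal to [u]. *)
Lemma gram_posdef n (u v : 'rV[R]_n) :
  (forall c d : R, c *: u + d *: v = 0 -> c = 0 /\ d = 0) ->
  0 < dot u u /\ 0 < dot u u * dot v v - dot u v ^+ 2.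
Proof.
move=> indep.
have u0 : 0 < dot u u.
  rewrite lt_def dot_ge0 andbT dot_eq0; apply/eqP => u0.
  have [] := indep 1 0; first by rewrite u0 scaler0 scale0r addr0.
  by move/eqP; rewrite oner_eq0.
split=> //; rewrite -(pmulr_rgt0 _ u0).
have e : dot u u * (dot u u * dot v v - dot u v ^+ 2) =
    dot (- dot u v *: u + dot u u *: v) (- dot u v *: u + dot u u *: v).
  rewrite !(dotDl, dotDr, dotZl, dotZr) (dotC v u).
  by move: (dot u u) (dot u v) (dot v v) => p q r; ring.
rewrite e lt_def dot_ge0 andbT dot_eq0; apply/eqP => /indep[_ u0'].
by move: u0; rewrite u0' ltxx.
Qed.

Lemma det_gram n (u : 'I_2 -> 'rV[R]_n) :
  \det (\matrix_(i, j) dot (u i) (u j)) =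
  dot (u 0) (u 0) * dot (u 1) (u 1) - dot (u 0) (u 1) ^+ 2.
Proof. by rewrite det2 !mxE (dotC (u 1) (u 0)) expr2. Qed.

Section LinearForm.
Variables (V : normedModType R) (n : nat) (E : 'rV[R]_n).

Let dotl (u : 'rV[R]_n) := dot u E.

Let dotl_linear : linear dotl.
Proof. by move=> a u v; rewrite /dotl dotDl dotZl. Qed.

HB.instance Definition _ := GRing.isLinear.Build R 'rV[R]_n R _ dotl dotl_linear.

Let dotl_continuous : continuous dotl.
Proof.
move=> u; apply: differentiable_continuous.
rewrite (_ : dotl = \sum_i (fun v : 'rV[R]_n => v 0 i * E 0 i)); last first.
  by apply/funext => v; rewrite fct_sumE.
apply: differentiable_sum => i; apply: differentiableM => //.
exact: differentiable_coord.
Qed.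

Lemma smooth_open_dot (U : set V) (f : V -> 'rV[R]_n) : open U -> smooth_open U f ->
  smooth_open U (fun q => dot (f q) E) /\
  forall p v, U p -> 'D_v (fun q => dot (f q) E) p = dot ('D_v f p) E.
Proof. exact: (@smooth_open_linear _ _ _ _ dotl U f dotl_continuous). Qed.

End LinearForm.

Lemma schwarz_row (V : normedModType R) n (U : set V) (f : V -> 'rV[R]_n) p u v :
  open U -> smooth_open U f -> U p ->
  'D_v (fun q => 'D_u f q) p = 'D_u (fun q => 'D_v f q) p.
Proof.
move=> oU sf Up; apply/rowP => k; rewrite -[LHS]dot_delta -[RHS]dot_delta.
have [sk dk] := smooth_open_dot (delta_mx 0 k) oU sf.
have dd a b : 'D_b (fun q => 'D_a (fun q => dot (f q) (delta_mx 0 k)) q) p =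
    dot ('D_b (fun q => 'D_a f q) p) (delta_mx 0 k).
  have [_ <-//] := smooth_open_dot (delta_mx 0 k) oU (smooth_open_derive a sf).
  by apply: (derive_eq_open _ oU _ Up) => q Uq; exact: dk.
exact: (etrans (esym (dd u v)) (etrans (schwarz u v oU sk Up) (dd v u))).
Qed.

Lemma immersion_posdef (f : 'rV[R]_2 -> 'rV[R]_3) (w : 'rV[R]_2) :
  differentiable f w -> injective ('d f w) ->
  0 < dot (partial 0 f w) (partial 0 f w) /\
  0 < dot (partial 0 f w) (partial 0 f w) * dot (partial 1 f w) (partial 1 f w)
    - dot (partial 0 f w) (partial 1 f w) ^+ 2.
Proof.
move=> df injd; apply: gram_posdef => c d.
rewrite /partial !deriveE// -2!linearZ_LR -linearD => e0.
have /rowP v0 : c *: delta_mx 0 0 + d *: delta_mx 0 1 = 0 :> 'rV[R]_2.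
  by apply: injd; rewrite e0 linear0.
have := v0 0; have := v0 1; rewrite !mxE !eqxx (_ : (0 == 1 :> 'I_2) = false)//.
rewrite (_ : (1 == 0 :> 'I_2) = false)// !(mulr0, mulr1, addr0, add0r).
by move=> -> ->.
Qed.

(** Passing from the chart to the frame [e0], [e1] multiplies the three quadratic relations between
    g and h by the square of its determinant, so the invariants can be read off in any frame. *)
Lemma frame_identities (d : 'I_2 -> 'rV[R]_3) (dd : 'I_2 -> 'I_2 -> 'rV[R]_3)
    (e0 e1 : 'rV[R]_2) (n E1 E2 E3 : 'rV[R]_3) (a b : R) :
  let x i := coord E1 E2 E3 (frame5 (d 0) (d 1) (dd 0 0) (dd 0 1) (dd 1 1) e0 e1 i) in
  0 < dot (d 0) (d 0) ->
  0 < dot (d 0) (d 0) * dot (d 1) (d 1) - dot (d 0) (d 1) ^+ 2 ->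
  dd 1 0 = dd 0 1 -> dot n n = 1 -> (forall i, dot (d i) n = 0) ->
  char_poly (invmx (\matrix_(i, j) dot (d i) (d j)) *m
    \matrix_(i, j) - dot (dd i j) n) = ('X - a%:P) * ('X - b%:P) ->
  orthonormal3 E1 E2 E3 ->
  e0 0 0 * e1 0 1 - e0 0 1 * e1 0 0 != 0 ->
  [/\ 0 < D_ x, M_ x = a * b * D_ x ^+ 2, A_ x ^+ 2 = (a + b) ^+ 2 * D_ x ^+ 3 &
      forall k, A_ x * ((D_ x)^-1 * (D_ x)^-1 * N_ x k) =
        - (a + b) * coord E1 E2 E3 n k].
Proof.
move=> x g0 D0 ddC n1 nX cp E123 J0.
have uG : \matrix_(i, j) dot (d i) (d j) \in unitmx.
  by rewrite unitmxE unitfE det_gram gt_eqF.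
have [] := principal_curvatures_trace_det uG cp.
rewrite det_gram det2 !mxE ddC.
have := nX 1; have := nX 0; move: @x g0 D0 {uG nX cp ddC}.
move: (d 0) (d 1) (dd 0 0) (dd 0 1) (dd 1 1) => a0' a1 a00 a01 a11 {d dd}.
rewrite (dotC a1 a0') => x g0 D0 n0 n1' HE KE.
have gE i j : first_of add mul x i j = dot (frame5 a0' a1 a00 a01 a11 e0 e1 i)
  (frame5 a0' a1 a00 a01 a11 e0 e1 j) by exact: gdot_coord.
have hE i : dot3 add mul (x i) (coord E1 E2 E3 n) =
  dot (frame5 a0' a1 a00 a01 a11 e0 e1 i) n by exact: gdot_coord.
have DE : D_ x = (e0 0 0 * e1 0 1 - e0 0 1 * e1 0 0) ^+ 2 *
   (dot a0' a0' * dot a1 a1 - dot a0' a1 ^+ 2).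
  rewrite /gram_of !gE /= !(dotDl, dotDr, dotZl, dotZr) (dotC a1 a0').
  move: (dot a0' a0') (dot a0' a1) (dot a1 a1) => p q r; ring.
have D1 : 0 < D_ x by rewrite DE mulr_gt0// lt_def sqr_ge0 andbT expf_neq0.
have hyp := @hypersurface_identities R x (coord E1 E2 E3 n) a b.
cbv zeta in hyp; rewrite !gE !hE in hyp; move: hyp.
rewrite /frame5 /seq5 !(dotDl, dotDr, dotZl, dotZr) n0 n1' (dotC a1 a0').
move: HE KE DE; move: (dot a0' a0') (dot a0' a1) (dot a1 a1) (dot a00 n) (dot a01 n)
  (dot a11 n) => p q r h00 h01 h11 HE KE DE; case=> //.
- by rewrite gdot_coord.
- by ring.
- by ring.
- rewrite DE mulrCA HE; ring.
- rewrite DE mulrCA KE; ring.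
Qed.

(** Both invariants are quotients of expressions in A, D and M, which are computed from the
    parametrization without reference to a normal. *)
Lemma curvature_invariants_unique (f : 'rV[R]_2 -> 'rV[R]_3) (w : 'rV[R]_2)
    (n n' : 'rV[R]_3) (a b a' b' : R) :
  smooth_open setT f -> injective ('d f w) ->
  dot n n = 1 -> (forall i, dot (partial i f w) n = 0) ->
  dot n' n' = 1 -> (forall i, dot (partial i f w) n' = 0) ->
  char_poly (invmx (metric f w) *m second_form f n w) = ('X - a%:P) * ('X - b%:P) ->
  char_poly (invmx (metric f w) *m second_form f n' w) = ('X - a'%:P) * ('X - b'%:P) ->
  (a + b) ^+ 2 = (a' + b') ^+ 2 /\ a * b = a' * b'.
Proof.
move=> sf injd n1 nX n1' nX' cp cp'.
have df : differentiable f w by exact: smooth_open_differentiable sf I.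
have [g0 D0] := immersion_posdef df injd.
have J0 : (delta_mx 0 0 : 'rV[R]_2) 0 0 * (delta_mx 0 1 : 'rV[R]_2) 0 1 -
  (delta_mx 0 0 : 'rV[R]_2) 0 1 * (delta_mx 0 1 : 'rV[R]_2) 0 0 != 0.
  by rewrite !mxE /= mulr1 mulr0 subr0 oner_eq0.
have ids := @frame_identities (fun i => partial i f w)
  (fun i j => partial i (partial j f) w) _ _ _ _ _ _ _ _ g0 D0
  (schwarz_row _ _ openT sf I).
have [D1 M1 A1 _] := ids _ _ _ _ _ _ _ _ n1 nX cp (@orthonormal3_delta R) J0.
have [_ M2 A2 _] := ids _ _ _ _ _ _ _ _ n1' nX' cp' (@orthonormal3_delta R) J0.
split.
- have D3 := expf_neq0 3 (lt0r_neq0 D1).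
  by apply: (mulIf D3); apply: (etrans (esym A1)); exact: A2.
- have D2 := expf_neq0 2 (lt0r_neq0 D1).
  by apply: (mulIf D2); apply: (etrans (esym M1)); exact: M2.
Qed.

End Immersion.

(** * Evolution of the pinching under the flow *)

Section Flow.
Variable R : realType.
Notation pt := ('rV[R]_2 * R)%type.

Definition frame_field (E1 E2 E3 : 'rV[R]_3) (e0 e1 : 'rV[R]_2) (g : pt -> 'rV[R]_3)
    (q : pt) (i : nat) : nat -> R :=
  coord E1 E2 E3 (seq5 ('D_(e0, 0) g q) ('D_(e1, 0) g q)
    ('D_(e0, 0) (fun q => 'D_(e0, 0) g q) q)
    ('D_(e0, 0) (fun q => 'D_(e1, 0) g q) q)
    ('D_(e1, 0) (fun q => 'D_(e1, 0) g q) q) i).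

Lemma deriveDZ (V W : normedModType R) (f : V -> W) q (a b : R) u v : differentiable f
  q ->
  'D_(a *: u + b *: v) f q = a *: 'D_u f q + b *: 'D_v f q.
Proof. by move=> df; rewrite !deriveE// linearD !linearZ. Qed.

Lemma space_directionE (e : 'rV[R]_2) :
  (e, 0) = e 0 0 *: (delta_mx 0 0, 0) + e 0 1 *: (delta_mx 0 1, 0) :> pt.
Proof.
congr (_, _); last by rewrite /= !scaler0 addr0.
by rewrite {1}[e]row_sum_delta sum2.
Qed.

Lemma derive_space (W : normedModType R) (f : pt -> W) q (e : 'rV[R]_2) :
  differentiable f q -> 'D_(e, 0) f q =
    e 0 0 *: 'D_(delta_mx 0 0, 0) f q + e 0 1 *: 'D_(delta_mx 0 1, 0) f q.
Proof. by move=> df; rewrite -deriveDZ// -space_directionE. Qed.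

Lemma bilinear_expand (W : lmodType R) (p q p' q' : R) (y z a b b' c : W) :
  y = p' *: a + q' *: b -> z = p' *: b' + q' *: c -> b' = b ->
  p *: y + q *: z = (p * p') *: a + (p * q' + q * p') *: b + (q * q') *: c.
Proof. by move=> -> -> ->; rewrite !scalerDr !scalerA scalerDl !addrA. Qed.

Lemma derive_space2 (U : set pt) (g : pt -> 'rV[R]_3) q (e e' : 'rV[R]_2) : open U ->
  smooth_open U g -> U q ->
  'D_(e, 0) (fun q => 'D_(e', 0) g q) q =
    (e 0 0 * e' 0 0) *: 'D_(delta_mx 0 0, 0) (fun q => 'D_(delta_mx 0 0, 0) g q) q +
    (e 0 0 * e' 0 1 + e 0 1 * e' 0 0) *: 'D_(delta_mx 0 0, 0) (fun q => 'D_(delta_mx 0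
      1, 0) g q) q +
    (e 0 1 * e' 0 1) *: 'D_(delta_mx 0 1, 0) (fun q => 'D_(delta_mx 0 1, 0) g q) q.
Proof.
move=> oU sg Uq.
have sgi v := smooth_open_derive v sg.
have dg p : U p -> differentiable g p by exact: smooth_open_differentiable.
have dsgi v : differentiable (fun q => 'D_v g q) q by exact: smooth_open_differentiable
  Uq.
apply: (etrans (derive_space e (dsgi _))).
have step v : 'D_v (fun q => 'D_(e', 0) g q) q =
    e' 0 0 *: 'D_v (fun q => 'D_(delta_mx 0 0, 0) g q) q +
    e' 0 1 *: 'D_v (fun q => 'D_(delta_mx 0 1, 0) g q) q.
  apply: (etrans (derive_eq_open v oU (fun p Up => derive_space e' (dg p Up)) Uq)).
  have dd w : derivable (fun q => 'D_w g q) q v by apply: diff_derivable; exact: dsgi.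
  rewrite -(deriveZ (e' 0 0) (dd (delta_mx 0 0, 0))) -(deriveZ (e' 0 1) (dd (delta_mx 0
    1, 0))).
  exact: (deriveD (derivableZ (dd _)) (derivableZ (dd _))).
exact: (bilinear_expand _ _ (step _) (step _)
  (schwarz_row (delta_mx 0 0, 0) (delta_mx 0 1, 0) oU sg Uq)).
Qed.

Lemma frame_fieldE E1 E2 E3 e0 e1 (U : set pt) g q i : open U -> smooth_open U g -> U q ->
  frame_field E1 E2 E3 e0 e1 g q i =
  coord E1 E2 E3 (frame5 ('D_(delta_mx 0 0, 0) g q) ('D_(delta_mx 0 1, 0) g q)
    ('D_(delta_mx 0 0, 0) (fun q => 'D_(delta_mx 0 0, 0) g q) q)
    ('D_(delta_mx 0 0, 0) (fun q => 'D_(delta_mx 0 1, 0) g q) q)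
    ('D_(delta_mx 0 1, 0) (fun q => 'D_(delta_mx 0 1, 0) g q) q) e0 e1 i).
Proof.
move=> oU sg Uq; rewrite /frame_field; congr (coord _ _ _ _).
have d2 e e' := derive_space2 e e' oU sg Uq.
have dg : differentiable g q by exact: smooth_open_differentiable sg Uq.
have d1 e := derive_space e dg.
by case: i => [|[|[|[|i]]]]; [exact: d1|exact: d1|exact: d2|exact: d2|exact: d2].
Qed.

Variables (F : R -> R -> R) (T : R).
Variables (x : 'rV[R]_3 -> R -> 'rV[R]_3).
Variables (nu : 'rV[R]_3 -> R -> 'rV[R]_3) (k1 k2 : 'rV[R]_3 -> R -> R).
Hypothesis hF : admissible_speed F.
Hypothesis hsmooth : smooth_family T x.
Hypothesis hconvex : forall t, 0 <= t < T -> convex_embedding (x^~ t).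
Hypothesis hnu : forall z t, sphere2 z -> 0 <= t < T ->
      outward_unit_normal (x^~ t) z (nu z t).
Hypothesis hk : forall z t, sphere2 z -> 0 <= t < T ->
      principal_curvatures (x^~ t) z (nu z t) (k1 z t) (k2 z t).
Hypothesis hpos : forall z t, sphere2 z -> 0 <= t < T -> 0 < k1 z t /\ 0 < k2 z t.
Hypothesis hflow : forall z t, sphere2 z -> 0 <= t < T ->
      has_time_derivative T (x z) t (- F (k1 z t) (k2 z t) *: nu z t).

Definition pinching z t := (k1 z t + k2 z t) ^+ 2 / (k1 z t * k2 z t).

(** Derivatives are taken of [g], which is smooth on an open set that may contain negative times; it
    represents the flow only at times in [[0, T)]. *)
Definition chart_extension s (U : set pt) (g : pt -> 'rV[R]_3) :=
  [/\ open U, smooth_open U g &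
   forall w t, U (w, t) -> 0 <= t < T -> x (stereo s w) t = g (w, t)].

Lemma chart_extension_ex s w t : 0 <= t < T ->
  exists U g, chart_extension s U g /\ U (w, t).
Proof.
move=> tT; have [U [g [oU Up sg xg]]] := @hsmooth s (w, t) (conj I tT).
exists U, g; split => //; split => // w' t' Uw' tT'.
by apply: (xg (w', t')); rewrite inE; split => //; split.
Qed.

Section Extension.
Variables (s : bool) (U : set pt) (g : pt -> 'rV[R]_3).
Hypothesis ext : chart_extension s U g.

Let oU : open U. Proof. by case: ext. Qed.
Let sg : smooth_open U g. Proof. by case: ext. Qed.
Let xg w t : U (w, t) -> 0 <= t < T -> x (stereo s w) t = g (w, t).
Proof. by case: ext => _ _; apply. Qed.

Lemma near_slice w t : U (w, t) -> \forall w' \near w, U (w', t).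
Proof.
move=> Up; have := open_nbhs_nbhs (conj oU Up : open_nbhs (w, t) U).
case=> -[A B] /= [Aw Bt] ABU; apply: filterS Aw => w' Aw'.
by apply: (ABU (w', t)); split => //; exact: nbhs_singleton.
Qed.

Lemma partial_extension w t i : U (w, t) -> 0 <= t < T ->
  partial i (x^~ t \o stereo s) w = 'D_(delta_mx 0 i, 0) g (w, t).
Proof.
move=> Uwt tT; rewrite -derive_slice; apply: near_eq_derive.
by apply: filterS (near_slice Uwt) => w' Uw'; exact: xg.
Qed.

Lemma partial2_extension w t i j : U (w, t) -> 0 <= t < T ->
  partial i (partial j (x^~ t \o stereo s)) w =
  'D_(delta_mx 0 i, 0) (fun q => 'D_(delta_mx 0 j, 0) g q) (w, t).
Proof.
move=> Uwt tT; rewrite -(derive_slice (fun q => 'D_(delta_mx 0 j, 0) g q)).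
apply: near_eq_derive.
by apply: filterS (near_slice Uwt) => w' Uw'; exact: partial_extension.
Qed.

Lemma pinching_factor (a b d : R) : 0 < a -> 0 < b ->
  (a + b) ^+ 2 * d ^+ 3 = (a + b) ^+ 2 / (a * b) * (d * (a * b * d ^+ 2)).
Proof. by move=> a0 b0; field; rewrite !gt_eqF. Qed.

(** This exchanges the given curvatures and normal, of unknown regularity, for polynomials in
    derivatives of [g], in frames that do not vary with the point. *)
Lemma field_identities w t E1 E2 E3 (e0 e1 : 'rV[R]_2) : U (w, t) -> 0 <= t < T ->
  orthonormal3 E1 E2 E3 -> e0 0 0 * e1 0 1 - e0 0 1 * e1 0 0 != 0 ->
  let X := frame_field E1 E2 E3 e0 e1 g (w, t) in let z := stereo s w in
  [/\ 0 < D_ X, 0 < M_ X, A_ X * A_ X = pinching z t * (D_ X * M_ X) &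
      forall k, A_ X * ((D_ X)^-1 * (D_ X)^-1 * N_ X k) =
        - (k1 z t + k2 z t) * coord E1 E2 E3 (nu z t) k].
Proof.
move=> Uwt tT E123 J0; cbv zeta.
have XE : frame_field E1 E2 E3 e0 e1 g (w, t) = fun i => coord E1 E2 E3
    (frame5 (partial 0 (x^~ t \o stereo s) w) (partial 1 (x^~ t \o stereo s) w)
     (partial 0 (partial 0 (x^~ t \o stereo s)) w)
     (partial 0 (partial 1 (x^~ t \o stereo s)) w)
     (partial 1 (partial 1 (x^~ t \o stereo s)) w) e0 e1 i).
  apply/funext => i; rewrite (frame_fieldE _ _ _ _ _ _ oU sg Uwt).
  have eq5 a0 a1 a00 a01 a11 b0 b1 b00 b01 b11 : a0 = b0 -> a1 = b1 -> a00 = b00 ->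
      a01 = b01 -> a11 = b11 -> coord E1 E2 E3 (frame5 a0 a1 a00 a01 a11 e0 e1 i) =
      coord E1 E2 E3 (frame5 b0 b1 b00 b01 b11 e0 e1 i).
    by move=> -> -> -> -> ->.
  exact: (eq5 _ _ _ _ _ _ _ _ _ _ (esym (partial_extension 0 Uwt tT))
    (esym (partial_extension 1 Uwt tT)) (esym (partial2_extension 0 0 Uwt tT))
    (esym (partial2_extension 0 1 Uwt tT)) (esym (partial2_extension 1 1 Uwt tT))).
have zS := @stereo_sphere R s w.
have [[sf injd _] _] := hconvex tT.
have [n1 nX _] := hnu zS tT.
have df := smooth_open_differentiable (sf s) (I : setT w).
have [g0 D0] := immersion_posdef df (@injd s w).
have [a0 b0] := hpos zS tT.
rewrite XE.
have [D1 M1 A1 N1] := @frame_identities R (fun i => partial i (x^~ t \o stereo s) w)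
  (fun i j => partial i (partial j (x^~ t \o stereo s)) w) e0 e1 _ E1 E2 E3 _ _
  g0 D0 (schwarz_row _ _ openT (sf s) I) n1 (fun i => nX s w erefl i)
  (hk zS tT erefl) E123 J0.
split.
- exact: D1.
- rewrite M1; exact: mulr_gt0 (mulr_gt0 a0 b0) (exprn_gt0 2 D1).
- rewrite M1 -expr2 A1; exact: pinching_factor.
- exact: N1.
Qed.

Lemma velocity_extension w t : U (w, t) -> 0 < t < T ->
  'D_(0, 1) g (w, t) =
  - F (k1 (stereo s w) t) (k2 (stereo s w) t) *: nu (stereo s w) t.
Proof.
move=> Uwt tT; have tT' : 0 <= t < T by case/andP: tT => /ltW -> ->.
have zS := @stereo_sphere R s w; set v := _ *: _.
have lim_v : (fun h : R => h^-1 *: ((g \o shift (w, t)) (h *: (0, 1)) - g (w, t)))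
    @ 0^' --> v.
  apply/cvgrPdist_le => e e0.
  have fl : \forall u \near t, u != t -> 0 <= u < T ->
      `|v - (u - t)^-1 *: (x (stereo s w) u - x (stereo s w) t)| <= e.
    have /cvgrPdist_le/(_ e e0) := hflow zS tT'.
    by rewrite near_withinE near_withinE; apply: filterS => u fu ut /(fu ut).
  have shc : (fun h : R => h + t) @ (0 : R) --> t.
    have hc : (fun h : R => h + t) @ (0 : R) --> 0 + t.
      by apply: cvgD; [exact: cvg_id|exact: cvg_cst].
    by move: hc; rewrite add0r.
  have inT : \forall u \near t, 0 < u < T.
    by case/andP: tT => t0 tT1; near=> u; apply/andP; split; near: u;
      [exact: lt_nbhsr|exact: lt_nbhsl].
  have inU : \forall h \near (0 : R), U (w, h + t).
    have := @near_line _ _ U (w, t) (0, 1) oU Uwt; apply: filterS => h.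
    rewrite (_ : (w, t) + h *: (0, 1) = (w, h + t))//.
    by congr (_, _); rewrite /= ?scaler0 ?addr0// addrC [h *: 1]mulr1.
  rewrite near_withinE.
  near=> h => h0.
  have hT : 0 < h + t < T by near: h; exact: (shc _ inT).
  have hT' : 0 <= h + t < T by case/andP: hT => /ltW -> ->.
  have hU : U (w, h + t) by near: h.
  have ht : h + t != t by rewrite -subr_eq0 addrK.
  have fh : h + t != t -> 0 <= h + t < T ->
    `|v - (h + t - t)^-1 *: (x (stereo s w) (h + t) - x (stereo s w) t)| <= e.
    by near: h; exact: (shc _ fl).
  move: fh; rewrite addrK => /(_ ht hT').
  rewrite !xg//= (_ : h *: (0, 1) + (w, t) = (w, h + t))//.
  by congr (_, _); rewrite /= ?scaler0 ?add0r// [h *: 1]mulr1.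
exact: cvg_lim lim_v.
Unshelve. all: by end_near. Qed.

Lemma coordZ E1 E2 E3 (c : R) u k : coord E1 E2 E3 (c *: u) k = c * coord E1 E2 E3 u k.
Proof. by case: k => [|[|k]] /=; rewrite dotZl. Qed.

(** The flow equation in terms of [g] alone. It holds at all points of [U] at positive times before
    [T], and so can be expanded along lines in space. *)
Lemma velocity_identity w t E1 E2 E3 (e0 e1 : 'rV[R]_2) : U (w, t) -> 0 < t < T ->
  orthonormal3 E1 E2 E3 -> e0 0 0 * e1 0 1 - e0 0 1 * e1 0 0 != 0 ->
  forall k, coord E1 E2 E3 ('D_(0, 1) g (w, t)) k =
    velocity (psi F) (frame_field E1 E2 E3 e0 e1 g (w, t)) k.
Proof.
move=> Uwt tT E123 J0 k; have tT' : 0 <= t < T by case/andP: tT => /ltW -> ->.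
have [D0 M0 AE NE] := field_identities Uwt tT' E123 J0.
have [a0 b0] := hpos (@stereo_sphere R s w) tT'.
rewrite velocity_extension// coordZ /velocity AE mulfK ?gt_eqF ?mulr_gt0//.
by rewrite [RHS]mulrAC NE (speed_psi hF a0 b0) /pinching; ring.
Qed.

End Extension.
Definition iterated_derive (V W : normedModType R) (g : V -> W) (vs : seq V) : V -> W :=
  foldr (fun v (h : V -> W) => fun q => 'D_v h q) g vs.

Lemma smooth_open_iterated (V W : normedModType R) (U : set V) (g : V -> W) vs :
  smooth_open U g -> smooth_open U (iterated_derive g vs).
Proof. by move=> sg; elim: vs => //= v vs; exact: smooth_open_derive. Qed.

(** By [schwarz_row] a direction can be moved past its neighbors to the front; induction on the list
    does the rest. *)
Lemma iterated_derive_perm (V : normedModType R) n (U : set V) (g : V -> 'rV[R]_n) vs ws :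
  open U -> smooth_open U g -> perm_eq vs ws ->
  forall p, U p -> iterated_derive g vs p = iterated_derive g ws p.
Proof.
move=> oU sg.
have front v l1 l2 : forall p, U p ->
    iterated_derive g (v :: l1 ++ l2) p = iterated_derive g (l1 ++ v :: l2) p.
  elim: l1 => [//|u l1 IH] p Up.
  apply: (etrans _ (derive_eq_open u oU IH Up)).
  exact: (schwarz_row u v oU (smooth_open_iterated (l1 ++ l2) sg) Up).
elim: vs ws => [|v vs IH] ws.
  by rewrite perm_sym => /perm_nilP ->.
move=> vws; have vw : v \in ws by rewrite -(perm_mem vws) mem_head.
case/splitPr: vw vws => l1 l2; rewrite perm_sym perm_catC /= perm_cons => vws p Up.
rewrite -front//; apply: (derive_eq_open v oU _ Up) => q Uq.
by apply: IH => //; rewrite perm_sym perm_catC.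
Qed.

Lemma jet2_coord E1 E2 E3 (U : set pt) (h : pt -> 'rV[R]_3) p u k :
  open U -> smooth_open U h -> U p ->
  jet2 (fun s => coord E1 E2 E3 (h (p + s *: u)) k)
    (jline (coord E1 E2 E3 (h p)) (coord E1 E2 E3 ('D_u h p))
      (coord E1 E2 E3 ('D_u (fun q => 'D_u h q) p)) k).
Proof.
move=> oU sh Up.
have jdot E : jet2 (fun s => dot (h (p + s *: u)) E)
    (dot (h p) E, dot ('D_u h p) E, dot ('D_u (fun q => 'D_u h q) p) E).
  have [sd dE] := smooth_open_dot E oU sh.
  have [_ dE2] := smooth_open_dot E oU (smooth_open_derive u sh).
  rewrite -dE// -dE2//.
  rewrite -(derive_eq_open u oU (fun q Uq => dE q u Uq) Up).
  exact: (jet2_line u oU sd Up).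
by case: k => [|[|k]]; exact: jdot.
Qed.

Lemma principal_frame_vectors (a0 a1 a00 a01 a11 n : 'rV[R]_3) :
  [/\ 0 < dot a0 a0, 0 < dot a0 a0 * dot a1 a1 - dot a0 a1 ^+ 2,
      dot a0 n = 0, dot a1 n = 0 & dot n n = 1] ->
  exists e0 e1 : 'rV[R]_2,
  let f := frame5 a0 a1 a00 a01 a11 e0 e1 in
  [/\ e0 0 0 * e1 0 1 - e0 0 1 * e1 0 0 != 0, orthonormal3 (f 0%N) (f 1%N) n &
      dot (f 3) n = 0].
Proof.
case=> g0 D0 n0 n1 nn.
have [e00 [e01 [e10 [e11 [E1 E2 E3 E4]]]]] :=
  orthonormal_frame (dot a00 n) (dot a01 n) (dot a11 n) g0 D0.
pose e0 : 'rV[R]_2 := \row_i [:: e00; e01]`_i.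
pose e1 : 'rV[R]_2 := \row_i [:: e10; e11]`_i.
exists e0, e1 => /=.
have [-> -> -> ->] : [/\ e0 0 0 = e00, e0 0 1 = e01, e1 0 0 = e10 & e1 0 1 = e11].
  by rewrite !mxE.
rewrite /orthonormal3 !(dotDl, dotDr, dotZl, dotZr) n0 n1 (dotC a1 a0).
(* For an orthonormal frame the left-hand side is 1, hence the determinant is nonzero. *)
have J := frame_change e00 e01 e10 e11 (dot a0 a0) (dot a0 a1) (dot a1 a1).
move: (dot a0 a0) (dot a0 a1) (dot a1 a1) (dot a00 n) (dot a01 n) (dot a11 n)
  E1 E2 E3 E4 J D0 => g00 g01 g11 h00 h01 h11 E1 E2 E3 E4 J D0.
split.
- apply/eqP => J0; move: J; rewrite E1 E2 E3 J0 => /eqP.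
  by rewrite expr0n mul0r mulr1 subr0 oner_eq0.
- by split => //; split; [rewrite -[RHS]E3|..]; ring.
- by rewrite -[RHS]E4; ring.
Qed.

Section GoodFrame.
Variables (s : bool) (U : set pt) (g : pt -> 'rV[R]_3).
Hypothesis ext : chart_extension s U g.

Lemma principal_frame w t : U (w, t) -> 0 <= t < T ->
  exists e0 e1 : 'rV[R]_2, let n := nu (stereo s w) t in
  [/\ e0 0 0 * e1 0 1 - e0 0 1 * e1 0 0 != 0,
      orthonormal3 ('D_(e0, 0) g (w, t)) ('D_(e1, 0) g (w, t)) n &
      dot ('D_(e0, 0) (fun q => 'D_(e1, 0) g q) (w, t)) n = 0].
Proof.
move=> Uwt tT.
have [oU sg _] := ext.
have zS := @stereo_sphere R s w.
have [[sf injd _] _] := hconvex tT.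
have [n1 nX _] := hnu zS tT.
have df := smooth_open_differentiable (sf s) (I : setT w).
have [g0 D0] := immersion_posdef df (@injd s w).
have transfer (P : 'rV[R]_3 -> 'rV[R]_3 -> Prop) a0 b0 a1 b1 :
  a0 = b0 -> a1 = b1 -> P a0 a1 -> P b0 b1 by move=> -> ->.
have pos := transfer (fun a0 a1 => [/\ 0 < dot a0 a0,
  0 < dot a0 a0 * dot a1 a1 - dot a0 a1 ^+ 2, dot a0 (nu (stereo s w) t) = 0,
  dot a1 (nu (stereo s w) t) = 0 & dot (nu (stereo s w) t) (nu (stereo s w) t) = 1])
  _ _ _ _ (partial_extension ext 0 Uwt tT) (partial_extension ext 1 Uwt tT)
  (And5 g0 D0 (nX s w erefl 0) (nX s w erefl 1) n1).
have dg : differentiable g (w, t) by exact: smooth_open_differentiable sg Uwt.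
have [e0 [e1 [J0 E12 h01]]] := principal_frame_vectors
  ('D_(delta_mx 0 0, 0) (fun q => 'D_(delta_mx 0 0, 0) g q) (w, t))
  ('D_(delta_mx 0 0, 0) (fun q => 'D_(delta_mx 0 1, 0) g q) (w, t))
  ('D_(delta_mx 0 1, 0) (fun q => 'D_(delta_mx 0 1, 0) g q) (w, t)) pos.
exists e0, e1; split => //.
- exact: (transfer (fun a b => orthonormal3 a b (nu (stereo s w) t)) _ _ _ _
    (esym (derive_space e0 dg)) (esym (derive_space e1 dg)) E12).
- exact: (etrans (congr1 (fun a => dot a (nu (stereo s w) t))
    (derive_space2 e0 e1 oU sg Uwt)) h01).
Qed.

End GoodFrame.

Lemma vec3_eq (y0 y1 y2 z0 z1 z2 : R) : y0 = z0 -> y1 = z1 -> y2 = z2 ->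
  vec3 y0 y1 y2 = vec3 z0 z1 z2.
Proof. by move=> -> -> ->. Qed.

Lemma adapted_frame_values (y : nat -> nat -> R) :
  y 0%N = vec3 1 0 0 -> y 1%N = vec3 0 1 0 -> y 3 2 = 0 ->
  [/\ A_ y = y 2 2 + y 4 2, D_ y = 1 & M_ y = y 2 2 * y 4 2].
Proof.
move=> y0 y1 y3; rewrite /mean_of /gauss_of /gram_of /second_of /first_of /dot3
  /normal_of /cross3 y0 y1 y3 /vec3.
by split; ring.
Qed.

Lemma pinched_neq (l m : R) : 0 < l * m -> 4 < (l + m) ^+ 2 / (l * m) -> l != m.
Proof.
move=> lm0 p4; apply/eqP => lm; move: p4 lm0; rewrite {}lm => p4 mm0.
by move: p4; rewrite (_ : (m + m) ^+ 2 = 4 * (m * m)) ?mulfK ?ltxx ?gt_eqF//; ring.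
Qed.

Lemma ler_sub_penalty (q q' e t r : R) :
  q' - e * (t + r) <= q - e * t -> q' - q <= e * r.
Proof. by move=> h; rewrite lerBlDl; move: h; rewrite mulrDr; lra. Qed.

Lemma defect_factor (l m q d : R) : 0 < l * m ->
  l * m * (q * d) - (l + m) ^+ 2 * d = l * m * (q - (l + m) ^+ 2 / (l * m)) * d.
Proof.
rewrite lt_def mulf_eq0 negb_or => /andP[/andP[l0 m0] _].
by field; rewrite l0 m0.
Qed.

(** Both the chart directions [e0'], [e1'] and the frame of space are frozen at the maximum point:
    the latter consists of the tangent vectors along [e0'], [e1'] and the normal there. *)
Lemma no_local_max s w t e : 0 < t < T -> 4 < pinching (stereo s w) t -> 0 < e ->
  (forall z' t', sphere2 z' -> 0 <= t' <= t ->
    pinching z' t' - e * t' <= pinching (stereo s w) t - e * t) -> False.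
Proof.
move=> tT p4 e0 gmax; have tT' : 0 <= t < T by case/andP: tT => /ltW -> ->.
have [U [g [ext Up]]] := chart_extension_ex s w tT'.
have [oU sg xg] := ext.
have [e0' [e1' [J0 E123 h01]]] := principal_frame ext Up tT'.
set n := nu _ t in E123 h01.
set E1 := 'D_(e0', 0) g (w, t) in E123 *; set E2 := 'D_(e1', 0) g (w, t) in E123 *.
pose p : pt := (w, t).
pose c vs := coord E1 E2 n (iterated_derive g vs p).
pose X (u : pt) (r : R) := frame_field E1 E2 n e0' e1' g (p + r *: u).
pose V (u : pt) (r : R) := coord E1 E2 n ('D_(0, 1) g (p + r *: u)).
have si vs := smooth_open_iterated vs sg.
have cperm vs ws : perm_eq vs ws -> c vs = c ws.
  by move=> vws; rewrite /c (iterated_derive_perm oU sg vws Up).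
have cvec vs : c vs = vec3 (c vs 0) (c vs 1) (c vs 2) by [].
have [E11 E22 nn [E12 E1n E2n]] := E123.
have ca : c [:: (e0', 0)] = vec3 1 0 0.
  exact: (vec3_eq E11 E12 E1n).
have cb : c [:: (e1', 0)] = vec3 0 1 0.
  exact: (vec3_eq (etrans (dotC _ _) E12) E22 E2n).
have cab : c [:: (e0', 0); (e1', 0)] 2 = 0 by exact: h01.
have Xj u i k : jet2 (fun r => X u r i k) (seq5
     (jline (c [:: (e0', 0)]) (c [:: u; (e0', 0)]) (c [:: u; u; (e0', 0)]))
     (jline (c [:: (e1', 0)]) (c [:: u; (e1', 0)]) (c [:: u; u; (e1', 0)]))
     (jline (c [:: (e0', 0); (e0', 0)]) (c [:: u; (e0', 0); (e0', 0)])
       (c [:: u; u; (e0', 0); (e0', 0)]))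
     (jline (c [:: (e0', 0); (e1', 0)]) (c [:: u; (e0', 0); (e1', 0)])
       (c [:: u; u; (e0', 0); (e1', 0)]))
     (jline (c [:: (e1', 0); (e1', 0)]) (c [:: u; (e1', 0); (e1', 0)])
       (c [:: u; u; (e1', 0); (e1', 0)])) i k).
  have j vs := jet2_coord E1 E2 n u k oU (si vs) Up.
  case: i => [|[|[|[|i]]]].
  - exact: (j [:: (e0', 0)]).
  - exact: (j [:: (e1', 0)]).
  - exact: (j [:: (e0', 0); (e0', 0)]).
  - exact: (j [:: (e0', 0); (e1', 0)]).
  - exact: (j [:: (e1', 0); (e1', 0)]).
have Vj u k : jet2 ((V u)^~ k)
     (jline (c [:: (0, 1)]) (c [:: u; (0, 1)]) (c [:: u; u; (0, 1)]) k).
  exact: (jet2_coord E1 E2 n u k oU (si [:: (0, 1)]) Up).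
pose l := c [:: (e0', 0); (e0', 0)] 2; pose m := c [:: (e1', 0); (e1', 0)] 2.
have [D0 M0 AE _] := field_identities ext Up tT' E123 J0.
have [Al D1 Ml] := adapted_frame_values (y := frame_field E1 E2 n e0' e1' g (w, t)) ca
  cb cab.
rewrite Al D1 Ml mul1r -/l -/m in AE M0.
have cE : pinching (stereo s w) t = (l + m) ^+ 2 / (l * m).
  by rewrite expr2 AE mulfK// gt_eqF.
have lDm : l != m by apply: pinched_neq M0 _; rewrite -cE.
have [Q [dQ P0 al be]] := psi_derive hF M0 lDm.
(* The defect is a positive multiple of the excess of the pinching over its value at the base point,
   so it inherits the maximum. *)
have PhiE w' t' : U (w', t') -> 0 <= t' < T ->
  let y := frame_field E1 E2 n e0' e1' g (w', t') in 0 < D_ y * M_ y /\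
  defect_of add sub mul (l * m) ((l + m) ^+ 2) y = l * m *
   (pinching (stereo s w') t' - pinching (stereo s w) t) * (D_ y * M_ y).
  move=> Up' tT1 y; have [D0' M0' AE' _] := field_identities ext Up' tT1 E123 J0.
  split; first exact: mulr_gt0.
  rewrite /defect_of AE' cE; exact: defect_factor M0.
have nearU u : \forall r \near (0 : R), U (p + r *: u) by exact: near_line oU Up.
have near_space (e' : 'rV[R]_2) : \forall r \near (0 : R),
    defect_of add sub mul (l * m) ((l + m) ^+ 2) (X (e', 0) r) <= 0 /\
    forall k, V (e', 0) r k = velocity (psi F) (X (e', 0) r) k.
  apply: filterS (nearU (e', 0)) => r.
  rewrite /X /V (_ : p + r *: (e', 0) = (w + r *: e', t)); last first.
    by congr (_, _); rewrite /= scaler0 addr0.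
  move=> Ur; have [DM ->] := PhiE _ _ Ur tT'; split; last first.
    exact: (velocity_identity ext Ur tT E123 J0).
  rewrite pmulr_lle0// pmulr_rle0// subr_le0 -(lerD2r (- (e * t))).
  by apply: gmax; [exact: stereo_sphere|case/andP: tT' => -> _ /=].
(* The slope is [l * m * e] rather than [e] because of the factor [l * m] in [PhiE]. *)
apply: (@no_interior_max_derivatives R pt (e0', 0) (e1', 0) (0, 1) c X V (psi F)
  (l * m * e) Q cperm cvec ca cb cab Xj Vj M0 lDm dQ P0 al be) => //.
- by move=> u [->|->]; exact: near_space.
- exact: mulr_gt0.
have nearT : \forall r \near (0 : R)^'-, 0 <= t + r.
  have nt : \forall r \near (0 : R), - t < r.
    by apply: lt_nbhsr; rewrite oppr_lt0; case/andP: tT.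
  have : \forall r \near (0 : R)^'-, - t < r by exact: cvg_within nt.
  by apply: filterS => r /ltW; rewrite addrC -lerBlDr sub0r.
have nearU' : \forall r \near (0 : R)^'-, U (p + r *: (0, 1)) by exact: cvg_within
  (nearU _).
near=> r; have r0 : r < 0 by near: r; exact: nbhs_left_lt.
have tr0 : 0 <= t + r by near: r.
have : U (p + r *: (0, 1)) by near: r.
rewrite /X (_ : p + r *: (0, 1) = (w, t + r)); last first.
  by congr (_, _); rewrite /= ?scaler0 ?addr0// [r *: 1]mulr1.
move=> Ur; have trT : 0 <= t + r < T.
  by rewrite tr0; case/andP: tT => _; apply: lt_trans; rewrite gtrDl.
have [DM ->] := PhiE _ _ Ur trT.
apply: ler_wpM2r; first exact: ltW.
rewrite -[l * m * e * r]mulrA; apply: ler_wpM2l; first exact: ltW.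
have := gmax (stereo s w) (t + r) (@stereo_sphere R s w); rewrite tr0 gerDl (ltW r0).
by move=> /(_ erefl); exact: ler_sub_penalty.
Unshelve. all: by end_near. Qed.

(** * Continuity of the pinching and existence of a maximum *)

Section Limits.
Variables (S : Type) (G : set_system S).
Context {FG : Filter G}.
Variables (y : S -> nat -> nat -> R) (y0 : nat -> nat -> R).
Hypothesis yc : forall i k, (fun q => y q i k) @ G --> y0 i k.

Let cD (f h : S -> R) (a b : R) : f @ G --> a -> h @ G --> b ->
  (fun q => f q + h q) @ G --> a + b.
Proof. exact: cvgD. Qed.

Let cB (f h : S -> R) (a b : R) : f @ G --> a -> h @ G --> b ->
  (fun q => f q - h q) @ G --> a - b.
Proof. exact: cvgB. Qed.

Let cM (f h : S -> R) (a b : R) : f @ G --> a -> h @ G --> b ->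
  (fun q => f q * h q) @ G --> a * b.
Proof. exact: cvgM. Qed.

Let cvg_dot u v (u0 v0 : nat -> R) : (forall k, (fun q => u q k) @ G --> u0 k) ->
  (forall k, (fun q => v q k) @ G --> v0 k) ->
  (fun q : S => dot3 add mul (u q) (v q)) @ G --> dot3 add mul u0 v0.
Proof.
by move=> uc vc; exact: (cD (cD (cM (uc 0%N) (vc 0%N)) (cM (uc 1%N) (vc 1%N)))
  (cM (uc 2%N) (vc 2%N))).
Qed.

Let cvg_normal k : (fun q => N_ (y q) k) @ G --> N_ y0 k.
Proof.
case: k => [|[|k]].
- exact: (cB (cM (@yc 0%N 1%N) (@yc 1%N 2%N)) (cM (@yc 0%N 2%N) (@yc 1%N 1%N))).
- exact: (cB (cM (@yc 0%N 2%N) (@yc 1%N 0%N)) (cM (@yc 0%N 0%N) (@yc 1%N 2%N))).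
- exact: (cB (cM (@yc 0%N 0%N) (@yc 1%N 1%N)) (cM (@yc 0%N 1%N) (@yc 1%N 0%N))).
Qed.

Let cvg_second i : (fun q => second_of add sub mul (y q) i) @ G --> second_of add sub
  mul y0 i.
Proof. exact: (cvg_dot (@yc i) (@cvg_normal)). Qed.

Let cvg_first i j : (fun q => first_of add mul (y q) i j) @ G --> first_of add mul y0 i j.
Proof. exact: (cvg_dot (@yc i) (@yc j)). Qed.

Lemma cvg_mean : (fun q => A_ (y q)) @ G --> A_ y0.
Proof.
exact: (cB (cD (cM (@cvg_first 1%N 1%N) (@cvg_second 2%N)) (cM (@cvg_first 0%N 0%N)
  (@cvg_second 4%N)))
  (cD (cM (@cvg_first 0%N 1%N) (@cvg_second 3%N)) (cM (@cvg_first 0%N 1%N) (@cvg_second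
    3%N)))).
Qed.

Lemma cvg_gram : (fun q => D_ (y q)) @ G --> D_ y0.
Proof.
exact: (cB (cM (@cvg_first 0%N 0%N) (@cvg_first 1%N 1%N)) (cM (@cvg_first 0%N 1%N)
  (@cvg_first 0%N 1%N))).
Qed.

Lemma cvg_gauss : (fun q => M_ (y q)) @ G --> M_ y0.
Proof. exact: (cB (cM (@cvg_second 2%N) (@cvg_second 4%N)) (cM (@cvg_second 3%N)
  (@cvg_second 3%N))). Qed.

End Limits.

Lemma cvg_frame_field E1 E2 E3 (e0 e1 : 'rV[R]_2) (U : set pt) (g : pt -> 'rV[R]_3) p i
  k :
  open U -> smooth_open U g -> U p ->
  (fun q => frame_field E1 E2 E3 e0 e1 g q i k) @ p --> frame_field E1 E2 E3 e0 e1 g p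
    i k.
Proof.
move=> oU sg Up.
have cvg_coord vs : (fun q => coord E1 E2 E3 (iterated_derive g vs q) k) @ p -->
    coord E1 E2 E3 (iterated_derive g vs p) k.
  have cdot E : (fun q => dot (iterated_derive g vs q) E) @ p --> dot (iterated_derive
    g vs p) E.
    have [sd _] := smooth_open_dot E oU (smooth_open_iterated vs sg).
    by have /differentiable_continuous := smooth_open_differentiable sd Up.
  by case: k => [|[|k]]; exact: cdot.
case: i => [|[|[|[|i]]]].
- exact: (cvg_coord [:: (e0, 0)]).
- exact: (cvg_coord [:: (e1, 0)]).
- exact: (cvg_coord [:: (e0, 0); (e0, 0)]).
- exact: (cvg_coord [:: (e0, 0); (e1, 0)]).
- exact: (cvg_coord [:: (e1, 0); (e1, 0)]).
Qed.

(** Near each point of [K] the pinching agrees within [K] with A^2 / (D M), computed from a smooth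
    extension in the standard frames. *)
Lemma pinching_within_continuous s (K : set pt) : K `<=` [set q | 0 <= q.2 < T] ->
  {within K, continuous (fun q => pinching (stereo s q.1) q.2)}.
Proof.
move=> KT; apply/subspace_continuousP => -[w t] Kp.
have tT := KT _ Kp; have [U [g [ext Up]]] := chart_extension_ex s w tT.
have [oU sg xg] := ext.
have J0 : (delta_mx 0 0 : 'rV[R]_2) 0 0 * (delta_mx 0 1 : 'rV[R]_2) 0 1 -
  (delta_mx 0 0 : 'rV[R]_2) 0 1 * (delta_mx 0 1 : 'rV[R]_2) 0 0 != 0.
  by rewrite !mxE /= mulr1 mulr0 subr0 oner_eq0.
pose y q := frame_field (delta_mx 0 0) (delta_mx 0 1) (delta_mx 0 2%:R)
  (delta_mx 0 0) (delta_mx 0 1) g q.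
pose phi q := A_ (y q) * A_ (y q) / (D_ (y q) * M_ (y q)).
have phiE w' t' : U (w', t') -> 0 <= t' < T ->
    0 < D_ (y (w', t')) * M_ (y (w', t')) /\ phi (w', t') = pinching (stereo s w') t'.
  move=> Uq tT'.
  have [D0 M0 AE _] := field_identities ext Uq tT' (@orthonormal3_delta R) J0.
  have DM := mulr_gt0 D0 M0; split; first exact: DM.
  by rewrite /phi AE mulfK// gt_eqF.
have [DM0 phip] := phiE _ _ Up tT.
have yc i k : (fun q => y q i k) @ (w, t) --> y (w, t) i k.
  exact: cvg_frame_field oU sg Up.
have phic : phi @ (w, t) --> phi (w, t).
  exact: (cvgM (cvgM (cvg_mean yc) (cvg_mean yc)) (cvgV (lt0r_neq0 DM0) (cvgM (cvg_gram
    yc) (cvg_gauss yc)))).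
have phicw : phi @ within K (nbhs (w, t)) --> pinching (stereo s w) t.
  by rewrite -phip; exact: cvg_within_filter phic.
apply: cvg_trans phicw; apply: near_eq_cvg.
rewrite near_withinE.
have : nbhs (w, t) U by exact: open_nbhs_nbhs.
apply: filterS => -[w' t'] Uq Kq.
by have [_ ->] := phiE w' t' Uq (KT _ Kq).
Qed.

(** In each chart the maximum is taken over a compact square times [[0, t0]]; the larger of the two
    is global by [stereo_surj]. *)
Lemma pinching_max (t0 e : R) : 0 <= t0 < T -> exists s w t, 0 <= t <= t0 /\
  forall z' t', sphere2 z' -> 0 <= t' <= t0 ->
    pinching z' t' - e * t' <= pinching (stereo s w) t - e * t.
Proof.
case/andP=> t00 t0T.
pose K : set pt := [set w : 'rV[R]_2 | forall i, `[-1, 1]%classic (w 0 i)] `*` `[0,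
  t0]%classic.
have KT : K `<=` [set q | 0 <= q.2 < T].
  move=> [w t] [_] /=; rewrite in_itv /= => /andP[-> tt0].
  exact: le_lt_trans t0T.
have cK : compact K.
  apply: compact_setX; last exact: segment_compact.
  exact: (@rV_compact R 2 (fun=> `[(-1 : R), 1]%classic) (fun=> @segment_compact R (-1)
    1)).
have K0 : K !=set0.
  exists (0, 0); split => /=; last by rewrite in_itv /= lexx.
  by move=> i; rewrite in_itv /= mxE lerN10 ler01.
have cont s : {within K, continuous (fun q => pinching (stereo s q.1) q.2 - e * q.2)}.
  have /subspace_continuousP h := pinching_within_continuous (s := s) KT.
  apply/subspace_continuousP => q Kq.
  have snd_cvg : snd @ within K (nbhs q) --> q.2 by apply: cvg_within_filter; exact:
    cvg_snd.
  have ec : (fun _ : pt => e) @ within K (nbhs q) --> e by exact: cvg_cst.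
  exact: (cvgB (h q Kq) (cvgM ec snd_cvg)).
have mx s := compact_EVT_max K0 cK (cont s).
have [[w1 t1] Kp1 m1] := mx false; have [[w2 t2] Kp2 m2] := mx true.
rewrite !inE in Kp1 Kp2.
have [s [w [t [Kwt m]]]] : exists s w t, K (w, t) /\ forall s' w' t', K (w', t') ->
    pinching (stereo s' w') t' - e * t' <= pinching (stereo s w) t - e * t.
  have [h|/ltW h] := leP (pinching (stereo false w1) t1 - e * t1)
      (pinching (stereo true w2) t2 - e * t2).
    exists true, w2, t2; split => // -[] w' t' Kq; first by apply: (m2 (w', t'));
      rewrite inE.
    by apply: le_trans h; apply: (m1 (w', t')); rewrite inE.
  exists false, w1, t1; split => // -[] w' t' Kq; last by apply: (m1 (w', t')); rewrite
    inE.
  by apply: le_trans h; apply: (m2 (w', t')); rewrite inE.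
exists s, w, t; split.
  by case: Kwt => _ /=; rewrite in_itv.
move=> z' t' /stereo_surj[s' [w' [w'1 <-]]] t't0; apply: m; split => /=.
  by move=> i; rewrite in_itv /=; exact: w'1.
by rewrite in_itv.
Qed.

Lemma pinching_ge4 z t : sphere2 z -> 0 <= t < T -> 4 <= pinching z t.
Proof.
move=> zS tT; have [a0 b0] := hpos zS tT.
rewrite /pinching ler_pdivlMr ?mulr_gt0//; move: (k1 z t) (k2 z t) => a b.
by rewrite -subr_ge0 (_ : _ - _ = (a - b) ^+ 2) ?sqr_ge0//; ring.
Qed.

Lemma pinching_le (c t : R) : 0 < t < T -> (forall z, sphere2 z -> pinching z 0 <= c) ->
  forall z, sphere2 z -> pinching z t <= c.
Proof.
case/andP=> t0 tT init z zS; rewrite leNgt; apply/negP => cp.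
have c4 : 4 <= c.
  by apply: le_trans (init z zS); apply: pinching_ge4 => //; rewrite lexx (lt_trans t0).
(* The penalty at time [t] is half the excess over [c], so the penalized value at [(z, t)] is still
   above [c]. The maximum is then not at time 0, and the pinching there exceeds [c], hence 4. *)
pose e := (pinching z t - c) / (2 * t).
have e0 : 0 < e by apply: divr_gt0; [rewrite subr_gt0|apply: mulr_gt0].
have [|s [w [t' [/andP[t'0 t't] mx]]]] := @pinching_max t e; first by rewrite (ltW t0).
have := mx z t zS; rewrite lexx (ltW t0) => /(_ erefl).
have -> : e * t = (pinching z t - c) / 2 by rewrite /e; field; rewrite gt_eqF.
have [t'E|t'N0] := eqVneq t' 0.
  have := init _ (@stereo_sphere R s w); rewrite t'E mulr0 subr0.
  move: (pinching _ _) (pinching _ _) cp => p q cp qc; lra.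
have et0 : 0 <= e * t' by rewrite mulr_ge0// ltW.
have t'pos : 0 < t' by rewrite lt_def t'N0.
move=> h; apply: (@no_local_max s w t' e) => //.
- by rewrite t'pos (le_lt_trans t't).
- move: et0 h; move: (e * t') (pinching _ t') (pinching _ t) cp => ? ? ? ? ? ?; lra.
- move=> z' t'' z'S /andP[t''0 t''t']; apply: mx => //.
  by rewrite t''0 (le_trans t''t').
Qed.

End Flow.

(** * From the pinching back to the ratio of the curvatures *)

Section Ratio.
Variable R : realType.
Implicit Types a b y z : R.

(** For negative [a] and [b] the quotient [r] is at most 1, but the right-hand side does not change
    under inversion of [r]. *)
Lemma sum_prod_ratio a b : 0 < a * b ->
  let r := Num.max a b / Num.min a b in (a + b) ^+ 2 / (a * b) = r + r^-1 + 2.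
Proof.
move=> ab0; have : a * b != 0 by rewrite gt_eqF.
rewrite mulf_eq0 negb_or => /andP[a0 b0] /=.
by rewrite /Num.max /Num.min; case: ifP => _; field; rewrite a0 b0.
Qed.

Lemma ltr_add_inv y z : 1 <= y -> y < z -> y + y^-1 < z + z^-1.
Proof.
move=> y1 yz; have y0 : 0 < y by exact: lt_le_trans y1.
have z0 : 0 < z by exact: lt_trans yz.
rewrite -subr_gt0 (_ : _ - _ = (z - y) * (y * z - 1) / (y * z)); last first.
  by field; rewrite !gt_eqF.
rewrite divr_gt0 ?mulr_gt0 ?subr_gt0//.
by rewrite (lt_le_trans (le_lt_trans y1 yz))// ler_peMl// ltW.
Qed.

Lemma ler_add_inv y z : 1 <= y -> y <= z -> y + y^-1 <= z + z^-1.
Proof.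
by move=> y1; rewrite le_eqVlt => /predU1P[->//|yz]; exact/ltW/ltr_add_inv.
Qed.

Lemma ratio_ge1 a b : 0 < a -> 0 < b -> 1 <= Num.max a b / Num.min a b.
Proof.
move=> a0 b0; rewrite ler_pdivlMr; last by rewrite lt_min a0.
by rewrite mul1r /Num.max /Num.min; case: ifP => [/ltW//|/negbT]; rewrite -leNgt.
Qed.

End Ratio.

(** The initial condition gives equality on the sphere only, whereas the maps are defined on the
    whole space. *)
Lemma outward_unit_normal_eq (R : realType) (f g : 'rV[R]_3 -> 'rV[R]_3) z n :
  (forall z, sphere2 z -> f z = g z) -> sphere2 z ->
  outward_unit_normal f z n -> outward_unit_normal g z n.
Proof.
move=> fg zS [n1 nX [K [cK fK] out]].
have fgs s : f \o stereo s = g \o stereo s.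
  by apply/funext => w; apply: fg; exact: stereo_sphere.
split=> // [s w|]; first by rewrite -fgs; exact: nX.
exists K; last by rewrite -fg.
split => //; rewrite -fK; apply/seteqP; split => [_ [y yS <-]|_ [y yS <-]].
  by exists y => //; exact: fg.
by exists y => //; rewrite fg.
Qed.

Lemma principal_curvatures_eq (R : realType) (f g : 'rV[R]_3 -> 'rV[R]_3) z n a b :
  (forall z, sphere2 z -> f z = g z) ->
  principal_curvatures f z n a b -> principal_curvatures g z n a b.
Proof.
move=> fg pc s w; rewrite -(_ : f \o stereo s = g \o stereo s); first exact: pc.
by apply/funext => w'; apply: fg; exact: stereo_sphere.
Qed.

Theorem proposition2 (R : realType) (F : R -> R -> R) (T : R)
    (x : 'rV[R]_3 -> R -> 'rV[R]_3) (x0 : 'rV[R]_3 -> 'rV[R]_3)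
    (nu : 'rV[R]_3 -> R -> 'rV[R]_3) (k1 k2 : 'rV[R]_3 -> R -> R)
    (hF : admissible_speed F)
    (hT : 0 < T)
    (hsmooth : smooth_family T x)
    (hconvex : forall t, 0 <= t < T -> convex_embedding (x^~ t))
    (hnu : forall z t, sphere2 z -> 0 <= t < T ->
      outward_unit_normal (x^~ t) z (nu z t))
    (hk : forall z t, sphere2 z -> 0 <= t < T ->
      principal_curvatures (x^~ t) z (nu z t) (k1 z t) (k2 z t))
    (hpos : forall z t, sphere2 z -> 0 <= t < T -> 0 < k1 z t /\ 0 < k2 z t)
    (hflow : forall z t, sphere2 z -> 0 <= t < T ->
      has_time_derivative T (x z) t (- F (k1 z t) (k2 z t) *: nu z t))
    (hinit : forall z, sphere2 z -> x z 0 = x0 z) :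
  forall t, 0 < t < T -> (pinching_ratio (x^~ t) <= pinching_ratio x0)%E.
Proof.
move=> t tT; have tT' : 0 <= t < T by case/andP: tT => /ltW -> ->.
have T0 : 0 <= (0 : R) < T by rewrite lexx.
have init z : sphere2 z ->
    ((Num.max (k1 z 0) (k2 z 0) / Num.min (k1 z 0) (k2 z 0))%:E <= pinching_ratio x0)%E.
  move=> zS; apply: ereal_sup_ubound; exists z, (nu z 0), (k1 z 0), (k2 z 0); split => //.
    exact: outward_unit_normal_eq hinit zS (hnu _ _ zS T0).
  exact: principal_curvatures_eq hinit (hk _ _ zS T0).
apply: ge_ereal_sup => _ [z [n [a [b [zS [n1 nX _] pc ->]]]]].
have [s [w [_ zE]]] := stereo_surj zS.
have [[sf injd _] _] := hconvex t tT'.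
have [nu1 nuX _] := hnu _ _ zS tT'.
(* n could a priori be the opposite of nu z t, but this changes neither
   (a + b)^2 nor a b. *)
have [ab_sum ab_prod] := curvature_invariants_unique (sf s) (@injd s w)
  n1 (nX s w zE) nu1 (nuX s w zE) (pc s w zE) (hk _ _ zS tT' s w zE).
have [p1 p2] := hpos _ _ zS tT'.
have ab0 : 0 < a * b by rewrite ab_prod mulr_gt0.
have pE : pinching k1 k2 z t = (a + b) ^+ 2 / (a * b) by rewrite /pinching ab_sum ab_prod.
rewrite leNgt; apply/negP; set r := _ / _ => lt_r.
have [q10 q20] := hpos _ _ zS T0.
(* The initial ratio is finite: [+oo] contradicts [lt_r], and [-oo] contradicts [init]. *)
have := init z zS; case: (pinching_ratio x0) init lt_r => [rho| |] init //.
rewrite lte_fin lee_fin => lt_r le_rho.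
have rho1 : 1 <= rho by apply: le_trans le_rho; exact: ratio_ge1.
have : pinching k1 k2 z t <= rho + rho^-1 + 2.
  apply: (pinching_le hF hsmooth hconvex hnu hk hpos hflow tT _ zS) => y yS.
  have [y1 y2] := hpos _ _ yS T0.
  rewrite /pinching sum_prod_ratio ?mulr_gt0// lerD2r ler_add_inv ?ratio_ge1//.
  by have := init y yS; rewrite lee_fin.
(* As [1 <= rho < r], strict monotonicity of [y + y^-1] on [[1, +oo)] contradicts the bound. *)
rewrite pE sum_prod_ratio// -/r lerD2r leNgt ltr_add_inv//.
Qed.
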